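(* Let $k\ge 2$ be an integer and $\delta\in\{0,1\}$. Let $\tau\in\mathbb C$ with $\Im(\tau)>0$ and $q=e^{2\pi\mathrm i\tau}$. Define $$S_\delta(k)=\sum_{\substack{0\le \ell<k\\ \ell-k\equiv \delta \pmod 2}}\left[\frac{\partial}{\partial z}\log\theta_2(z,q)\Big|_{z=\frac{\ell\pi}{2k}}\right]^2 .$$ Then if $\delta=0$, $$S_0(k)=4(k-2)\,q\frac{d}{dq}\log\left(\frac{\eta(k\tau)}{\eta(\tau)}\right),$$ and if $\delta=1$, $$S_1(k)=4\,q\frac{d}{dq}\log\left(\frac{\eta(2k\tau)^{2k-2}}{\eta(\tau)^k\,\eta(k\tau)^{k-2}}\right).$$
   Context: For $z\in\mathbb C$ and $q=e^{2\pi\mathrm i\tau}$ with $\Im(\tau)>0$, the Jacobi theta function is $\theta_2(z,q)=\sum_{n\in\mathbb Z}q^{(2n+1)^2/8}e^{\mathrm i(2n+1)z}$, where $q^{a}$ means $e^{2\pi\mathrm i a\tau}$. The Dedekind eta function is $\eta(\tau)=q^{1/24}\prod_{n\ge1}(1-q^n)$, and $\eta(\alpha\tau)$ denotes it evaluated at $\alpha\tau$. The operator $q\frac{d}{dq}$ equals $\frac{1}{2\pi\mathrm i}\frac{d}{d\tau}$. *)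

(* Defs.v *)
From mathcomp Require Import all_boot all_order all_algebra.
From mathcomp Require Import all_classical all_reals all_analysis.
From mathcomp Require Import complex.

Set Implicit Arguments.
Unset Strict Implicit.
Unset Printing Implicit Defensive.

Import Order.TTheory GRing.Theory Num.Theory.
Import numFieldNormedType.Exports.

Local Open Scope classical_set_scope.
Local Open Scope ring_scope.
Local Open Scope complex_scope.

(* Sealed as a numClosedFieldType because MathComp-Analysis infers the topology
   and normed space given by the modulus for such a structure, but not for the
   concrete type R[i]. On functions CC R -> CC R, derive1 is the complex
   derivative. *)
Definition CC (R : realType) : numClosedFieldType := R[i].

Section Defs.
Variable R : realType.
Implicit Types (z tau a : CC R) (f : CC R -> CC R).

Definition cexp z : CC R :=
  let x := complex.Re z in let y := complex.Im z in
  (expR x * cos y) +i* (expR x * sin y).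

Definition ci : CC R := 0 +i* 1.

Definition cpi : CC R := (pi : R)%:C.

(* q^a for q = e^(2 pi i tau): the branch is determined by tau. *)
Definition qpow tau a : CC R := cexp (2 * cpi * ci * a * tau).

(* Negz n is the integer - (n + 1). *)
Definition sumZ (u : int -> CC R) : CC R :=
  \big[+%R/0]_(0 <= n <oo) u (Posz n) + \big[+%R/0]_(0 <= n <oo) u (Negz n).

Definition theta2 z tau : CC R :=
  sumZ (fun n : int => qpow tau ((2 * n%:~R + 1) ^+ 2 / 8)
                       * cexp (ci * (2 * n%:~R + 1) * z)).

Definition eta tau : CC R :=
  qpow tau (1 / 24) * \big[*%R/1]_(1 <= n <oo) (1 - qpow tau n%:R).

(* The derivative of log f at z, which is the same for every local branch of
   the logarithm. *)
Definition dlog f z : CC R := derive1 f z / f z.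

(* q d/dq log f, with f a function of tau and q d/dq = (2 pi i)^-1 d/dtau. *)
Definition qdq_log f tau : CC R := (2 * cpi * ci)^-1 * dlog f tau.

Definition Ssum (delta k : nat) tau : CC R :=
  \sum_(0 <= l < k | l == k + delta %[mod 2])
    dlog (fun z => theta2 z tau) (l%:R * cpi / (2 * k%:R)) ^+ 2.

End Defs.

(* Main.v *)
Require Import Defs.
From mathcomp Require Import all_boot all_order all_algebra.
From mathcomp Require Import all_classical all_reals all_analysis.
From mathcomp Require Import complex.
From mathcomp Require Import ring lra zify.

(* Put x = - e^(2 i z). By Jacobi's triple product (the limit of the q-binomial
   theorem), the logarithmic derivative of theta2 in z is - 2 i rho(x), where
     rho(x) = 1/2 + x/(1 - x) + sum_(m >= 1) (u_m - v_m),
     u_m = q^m x/(1 - q^m x),  v_m = (q^m/x)/(1 - q^m/x).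
   At the points of S_0(k), x runs through the k-th roots of unity other than 1
   up to x <-> 1/x, and rho(1/x) = - rho(x), so S_0(k) = - 2 sum rho(x)^2 over
   these roots. The addition theorem of the cotangent gives
     rho^2 = (1/2 + x/(1 - x))^2
       + sum_(m >= 1) (u_m + u_m^2 + v_m + v_m^2 - 2 m (u_m + v_m)) - 2 P(q),
     P(q) = sum_(m >= 1) m q^m/(1 - q^m),
   and summing over the roots of unity leaves P(q) and P(q^k), which are the
   logarithmic derivatives of eta(tau) and eta(k tau).
   Finally S_1(k) = S_0(2 k) - S_0(k). *)

(** Infinite products are not differentiated termwise: a second-order remainder is bounded uniformly
    in the number of factors, and the bound passes to the limit. Explicit geometric bounds, [geo],
    control every truncation error. The formula for rho^2 is the limit of an exact identity between
    truncations at N. A product of two cotangent terms, at q^M x and q^m x, is linear in the single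
    terms, with coefficients q^d/(1 - q^d) for d = M - m and d = M + m. Most of these cancel in the
    square, and for each m only a window N - m < d <= N + m is left. An index d <= N lies in exactly
    d of the windows, which is the origin of the weight d in P(q). Over all k-th roots of unity, u_m
    + u_m^2 sums to a multiple k^2 and u_m to a multiple k of Lambert terms in q^k. Both lead to
    P(q^k), so that it appears with k^2 - 2 k, whence the factor k - 2. *)

Set Implicit Arguments.
Unset Strict Implicit.
Unset Printing Implicit Defensive.

Import Order.TTheory GRing.Theory Num.Theory.
Import numFieldNormedType.Exports.

Local Open Scope classical_set_scope.
Local Open Scope ring_scope.

(** * The modulus as a real number *)


Section ComplexModulus.
Context {R : realType}.
Implicit Types (z w : CC R) (x y : R).

(** The norm of [CC R] is an element of [CC R], whose order is partial. Estimates are carried out in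
    [R], where [lra] and [nra] apply. *)
Definition cmod z : R := complex.Re `|z|.

Definition toCC x : CC R := x%:C%C.

Lemma cmodE z : `|z| = toCC (cmod z).
Proof. by rewrite /cmod /toCC; case: z => a b. Qed.

Lemma toCC_ler x y : (toCC x <= toCC y) = (x <= y).
Proof. exact: lecR. Qed.

Lemma toCC_inj : injective toCC.
Proof. by move=> x y []. Qed.

Lemma toCCD x y : toCC (x + y) = toCC x + toCC y.
Proof. exact: (rmorphD (real_complex R)). Qed.

Lemma toCCM x y : toCC (x * y) = toCC x * toCC y.
Proof. exact: (rmorphM (real_complex R)). Qed.

Lemma toCCX x n : toCC (x ^+ n) = toCC x ^+ n.
Proof. exact: (rmorphXn (real_complex R)). Qed.

Lemma toCCn n : toCC n%:R = n%:R.
Proof. exact: (rmorph_nat (real_complex R)). Qed.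

Lemma toCC1 : toCC 1 = 1. Proof. by []. Qed.

(** Comparable elements of [CC R] have equal imaginary parts, so the radii of its balls are real. *)
Lemma toCC_pos (e : CC R) : 0 < e -> exists2 r : R, 0 < r & e = toCC r.
Proof.
case: e => a b; rewrite ltcE /= => /andP[/eqP -> a0].
by exists a.
Qed.

Lemma cmod_ge0 z : 0 <= cmod z.
Proof. by rewrite -toCC_ler -cmodE; exact: normr_ge0. Qed.

Lemma cmodM z w : cmod (z * w) = cmod z * cmod w.
Proof. by apply: toCC_inj; rewrite toCCM -!cmodE normrM. Qed.

Lemma cmod_toCC x : cmod (toCC x) = `|x|.
Proof.
apply: toCC_inj; rewrite -cmodE normc_def /=.
by rewrite expr0n /= addr0 sqrtr_sqr.
Qed.

Lemma cmod1 : cmod 1 = 1.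
Proof. by rewrite -toCC1 cmod_toCC normr1. Qed.

Lemma cmod0 : cmod 0 = 0.
Proof. by apply: toCC_inj; rewrite -cmodE normr0. Qed.

Lemma cmod_nat n : cmod n%:R = n%:R.
Proof. by rewrite -toCCn cmod_toCC normr_nat. Qed.

Lemma cmodN z : cmod (- z) = cmod z.
Proof. by apply: toCC_inj; rewrite -!cmodE normrN. Qed.

Lemma cmodB z w : cmod (z - w) = cmod (w - z).
Proof. by rewrite -cmodN opprB. Qed.

Lemma cmodX z n : cmod (z ^+ n) = cmod z ^+ n.
Proof. by apply: toCC_inj; rewrite toCCX -!cmodE normrX. Qed.

Lemma cmodV z : cmod z^-1 = (cmod z)^-1.
Proof.
have [->|z0] := eqVneq z 0; first by rewrite invr0 cmod0 invr0.
have m0 : cmod z != 0.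
  by apply: contraNneq z0 => m0; rewrite -normr_eq0 cmodE m0.
by apply: (mulfI m0); rewrite -cmodM !mulfV // cmod1.
Qed.

Lemma cmodD z w : cmod (z + w) <= cmod z + cmod w.
Proof. by rewrite -toCC_ler toCCD -!cmodE ler_normD. Qed.

Lemma cmod_subD z w : cmod (z - w) <= cmod z + cmod w.
Proof. by rewrite -(cmodN w) cmodD. Qed.

Lemma cmod_eq0 z : (cmod z == 0) = (z == 0).
Proof.
apply/eqP/eqP => [m0|->]; last exact: cmod0.
by apply/eqP; rewrite -normr_eq0 cmodE m0.
Qed.

Lemma cmod_gt0 z : (0 < cmod z) = (z != 0).
Proof. by rewrite lt_def cmod_ge0 andbT cmod_eq0. Qed.

Lemma cmod_sum (I : Type) (r : seq I) (P : pred I) (f : I -> CC R) :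
  cmod (\sum_(i <- r | P i) f i) <= \sum_(i <- r | P i) cmod (f i).
Proof.
elim/big_ind2 : _ => [|a b c d ha hc|//]; first by rewrite cmod0.
by rewrite (le_trans (cmodD _ _))// lerD.
Qed.

Lemma cmod_prod (I : Type) (r : seq I) (P : pred I) (f : I -> CC R) :
  cmod (\prod_(i <- r | P i) f i) = \prod_(i <- r | P i) cmod (f i).
Proof. exact: (big_morph cmod cmodM cmod1). Qed.

Lemma cmod_Re z : `|complex.Re z| <= cmod z.
Proof. by rewrite -toCC_ler -cmodE; exact: normc_ge_Re. Qed.

Lemma cmod_Im z : `|complex.Im z| <= cmod z.
Proof.
rewrite -toCC_ler -cmodE normc_def toCC_ler -sqrtr_sqr.
by apply: ler_wsqrtr; rewrite lerDr sqr_ge0.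
Qed.

Lemma cmod_le_ReIm z : cmod z <= `|complex.Re z| + `|complex.Im z|.
Proof.
rewrite -toCC_ler -cmodE normc_def toCC_ler.
rewrite -[leRHS]ger0_norm ?addr_ge0// -[leRHS]sqrtr_sqr; apply: ler_wsqrtr.
rewrite sqrrD !real_normK ?num_real// lerD2r lerDl.
by rewrite mulrn_wge0// mulr_ge0.
Qed.

Lemma cvg_cmodP (T : Type) (F : set_system T) {FF : Filter F}
    (u : T -> CC R) (l : CC R) :
  (u t @[t --> F] --> l) <-> (cmod (u t - l) @[t --> F] --> (0 : R)).
Proof.
split=> [/cvgrPdist_le h|/cvgrPdist_le h]; apply/cvgrPdist_le => e e0.
  have {}h : \forall t \near F, `|l - u t| <= toCC e.
    by apply: h; rewrite ltcR.
  apply: filterS h => t; rewrite cmodE toCC_ler => h.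
  by rewrite sub0r normrN ger0_norm ?cmod_ge0// cmodB.
have [r r0 ->] := toCC_pos e0.
apply: filterS (h r r0) => t; rewrite sub0r normrN ger0_norm ?cmod_ge0//.
by rewrite cmodE toCC_ler cmodB.
Qed.

Lemma cvg_cmod_le (u : nat -> CC R) (l : CC R) (e : nat -> R) :
  (forall n, cmod (u n - l) <= e n) -> e n @[n --> \oo] --> (0 : R) ->
  u n @[n --> \oo] --> l.
Proof.
move=> ue e0; apply/cvg_cmodP.
apply: (squeeze_cvgr _ (cvg_cst (0 : R)) e0).
by near=> n; rewrite cmod_ge0 ue.
Unshelve. all: by end_near. Qed.

Lemma cvg_cmod (u : nat -> CC R) (l : CC R) :
  u n @[n --> \oo] --> l -> cmod (u n) @[n --> \oo] --> cmod l.
Proof.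
move=> /cvg_cmodP h; apply/cvgrPdistC_lt => e e0.
move/cvgrPdistC_lt : h => /(_ _ e0); apply: filterS => n.
rewrite subr0 ger0_norm ?cmod_ge0//; apply: le_lt_trans.
rewrite ler_norml; apply/andP; split.
  rewrite lerNl opprB lerBlDr cmodB.
  by rewrite (le_trans _ (cmodD _ _))// subrK.
by rewrite lerBlDr (le_trans _ (cmodD _ _))// subrK.
Qed.

Lemma cvg_cmod_ub (u : nat -> CC R) (l : CC R) (b : R) :
  u n @[n --> \oo] --> l -> (forall n, cmod (u n) <= b) -> cmod l <= b.
Proof.
move=> /cvg_cmod ul ub; apply: (cvgr_to_le ul).
by near=> n; exact: ub.
Unshelve. all: by end_near. Qed.

End ComplexModulus.

(** * The complex exponential *)


Section RealBounds.
Context {R : realType}.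
Implicit Types x y : R.

(** The bound on [c] makes the lemma iterable: a first-order estimate of [df] at [c] becomes a
    second-order estimate of [f] at [y], whatever the sign of [y]. *)
Lemma MVT_from0 (f df : R -> R) y :
  (forall x, is_derive x 1 f (df x)) ->
  exists2 c, `|c| <= `|y| & f y - f 0 = df c * y.
Proof.
move=> fdf.
have fc (a b : R) : {within `[a, b], continuous f}.
  by apply: derivable_within_continuous => x _; case: (fdf x).
have [y0|y0|->] := ltgtP y 0.
- have [c] := MVT y0 (fun x _ => fdf x) (fc _ _).
  rewrite in_itv/= => /andP[yc c0] e; exists c; last lra.
  by rewrite !ltr0_norm//; lra.
- have [c] := MVT y0 (fun x _ => fdf x) (fc _ _).
  rewrite in_itv/= => /andP[yc c0] e; exists c; last lra.
  by rewrite !gtr0_norm//; lra.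
- by exists 0; rewrite ?mulr0 ?subrr.
Qed.

Lemma sin_le_abs y : `|sin y| <= `|y|.
Proof.
have [c _] := @MVT_from0 sin cos y (fun x => is_derive_sin x).
rewrite sin0 subr0 => ->; rewrite normrM -[leRHS]mul1r.
by rewrite ler_wpM2r// cos_max.
Qed.

Lemma cos_sub1_le y : `|cos y - 1| <= `|y|.
Proof.
have [c _] := @MVT_from0 cos (- sin) y (fun x => is_derive_cos x).
rewrite cos0 => ->; rewrite normrM -[leRHS]mul1r.
by rewrite ler_wpM2r// normrN sin_max.
Qed.

Lemma cos_sub1_le2 y : `|cos y - 1| <= `|y| ^+ 2.
Proof.
have [c cy] := @MVT_from0 cos (- sin) y (fun x => is_derive_cos x).
rewrite cos0 => ->; rewrite normrM expr2.
by rewrite ler_wpM2r// normrN (le_trans (sin_le_abs _)).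
Qed.

Lemma sin_sub_le2 y : `|sin y - y| <= `|y| ^+ 2.
Proof.
have [c cy] := @MVT_from0 sin cos y (fun x => is_derive_sin x).
rewrite sin0 subr0 => e; rewrite {1}e -{2}(mul1r y) -mulrBl normrM expr2.
by rewrite ler_wpM2r// (le_trans (cos_sub1_le _)).
Qed.

Lemma expR_abs_ge1 x : 1 <= expR `|x|.
Proof. by rewrite -expR0 ler_expR. Qed.

(** Both signs follow from [1 + x <= expR x], applied at [x] and at [- x]. *)
Lemma expR_sub1_le x : `|expR x - 1| <= `|x| * expR `|x|.
Proof.
have h1 := expR_ge1Dx x; have h2 := expR_ge1Dx (- x).
have e : expR x * expR (- x) = 1 by rewrite -expRD subrr expR0.
have p1 := expR_gt0 x; have p2 := expR_gt0 (- x).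
have [x0|x0] := leP 0 x.
  rewrite ger0_norm; last lra.
  rewrite ger0_norm//; nra.
rewrite ltr0_norm ?(ltr0_norm x0); last by rewrite subr_lt0 -expR0 ltr_expR.
have := expR_abs_ge1 x; rewrite ltr0_norm//; nra.
Qed.

Lemma expR_sub1D_le x : `|expR x - 1 - x| <= `|x| ^+ 2 * expR `|x|.
Proof.
have h1 := expR_ge1Dx x; have h2 := expR_ge1Dx (- x).
have e : expR x * expR (- x) = 1 by rewrite -expRD subrr expR0.
have p1 := expR_gt0 x; have p2 := expR_gt0 (- x).
rewrite ger0_norm; last lra.
rewrite real_normK ?num_real//.
have h3 : expR x - 1 <= x * expR x by nra.
have [x0|x0] := leP 0 x.
  rewrite ger0_norm//; have : x * (expR x - 1) <= x * (x * expR x).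
    by rewrite ler_wpM2l.
  nra.
have h4 := expR_abs_ge1 x; have h5 := sqr_ge0 x.
have : expR x - 1 - x <= x ^+ 2 by nra.
nra.
Qed.

End RealBounds.

Section ComplexExponential.
Context {R : realType}.
Implicit Types z w : CC R.

Lemma complexP z w :
  complex.Re z = complex.Re w -> complex.Im z = complex.Im w -> z = w.
Proof. by case: z w => a b [c d] /= -> ->. Qed.

Lemma ccReD z w : complex.Re (z + w) = complex.Re z + complex.Re w.
Proof. by case: z w => a b [c d]. Qed.

Lemma ccImD z w : complex.Im (z + w) = complex.Im z + complex.Im w.
Proof. by case: z w => a b [c d]. Qed.

Lemma ccReM z w : complex.Re (z * w)
  = complex.Re z * complex.Re w - complex.Im z * complex.Im w.
Proof. by case: z w => a b [c d]. Qed.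

Lemma ccImM z w : complex.Im (z * w)
  = complex.Re z * complex.Im w + complex.Im z * complex.Re w.
Proof. by case: z w => a b [c d]. Qed.

Lemma cexpD z w : cexp (z + w) = cexp z * cexp w.
Proof.
apply: complexP; rewrite ?ccReM ?ccImM /= ccReD ccImD expRD ?cosD ?sinD; ring.
Qed.

Lemma cexp0 : cexp (0 : CC R) = 1.
Proof. by apply: complexP; rewrite /= expR0 ?cos0 ?sin0 mul1r. Qed.

Lemma cmod_cexp z : cmod (cexp z) = expR (complex.Re z).
Proof.
apply: toCC_inj; rewrite -cmodE normc_def /=; congr toCC.
by rewrite !exprMn -mulrDr cos2Dsin2 mulr1 sqrtr_sqr gtr0_norm ?expR_gt0.
Qed.

Lemma cexp_neq0 z : cexp z != 0.
Proof. by rewrite -cmod_gt0 cmod_cexp expR_gt0. Qed.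

Lemma cexpN z : cexp (- z) = (cexp z)^-1.
Proof.
by apply: (mulfI (cexp_neq0 z)); rewrite -cexpD subrr cexp0 mulfV// cexp_neq0.
Qed.

Lemma cexpMn z n : cexp (z * n%:R) = cexp z ^+ n.
Proof.
elim: n => [|n IH]; first by rewrite mulr0 cexp0 expr0.
by rewrite -[n.+1%:R]natr1 mulrDr mulr1 cexpD IH exprSr.
Qed.

Lemma cmod_ci : cmod (ci R) = 1.
Proof.
apply: toCC_inj; rewrite -cmodE normc_def /=; congr toCC.
by rewrite expr0n expr1n add0r sqrtr1.
Qed.

Definition cis (y : R) : CC R := Complex (cos y) (sin y).

Lemma cexp_cis z : cexp z = toCC (expR (complex.Re z)) * cis (complex.Im z).
Proof. by apply: complexP; rewrite ?ccReM ?ccImM /=; ring. Qed.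

Lemma cmod_cexp_sub1 z : cmod (cexp z - 1) <= 3 * (cmod z * expR (cmod z)).
Proof.
set x := complex.Re z; set y := complex.Im z; set m := cmod z.
have xm : `|x| <= m := cmod_Re z; have ym : `|y| <= m := cmod_Im z.
have m0 : 0 <= m := cmod_ge0 z.
have -> : cexp z - 1 = toCC (expR x - 1) + toCC (expR x) * (cis y - 1).
  by apply: complexP; rewrite !(ccReD, ccImD, ccReM, ccImM) /= -/x -/y; ring.
have em : expR `|x| <= expR m by rewrite ler_expR.
have e1 := expR_sub1_le x.
have ex : expR x <= expR m by rewrite ler_expR; move: xm; rewrite ler_norml; lra.
have c1 : cmod (cis y - 1) <= 2 * m.
  have := cmod_le_ReIm (cis y - 1); rewrite !(ccReD, ccImD) /= oppr0 addr0.
  have := cos_sub1_le y; have := sin_le_abs y; lra.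
apply: (le_trans (cmodD _ _)); rewrite cmodM !cmod_toCC.
have h1 : `|expR x - 1| <= m * expR m.
  by apply: (le_trans e1); apply: ler_pM => //; exact: expR_ge0.
have h2 : `|expR x| * cmod (cis y - 1) <= expR m * (2 * m).
  by apply: ler_pM => //; [exact: cmod_ge0 | rewrite gtr0_norm ?expR_gt0].
lra.
Qed.

(** This quadratic remainder is the source of complex differentiability, for the exponential itself
    and for the factors of the products. *)
Lemma cmod_cexp_sub1D z :
  cmod (cexp z - 1 - z) <= 4 * (cmod z ^+ 2 * expR (cmod z)).
Proof.
set x := complex.Re z; set y := complex.Im z; set m := cmod z.
have xm : `|x| <= m := cmod_Re z; have ym : `|y| <= m := cmod_Im z.
have m0 : 0 <= m := cmod_ge0 z.
have -> : cexp z - 1 - z = toCC (expR x - 1 - x)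
    + toCC (expR x) * (cis y - 1 - ci R * toCC y)
    + toCC (expR x - 1) * (ci R * toCC y).
  by apply: complexP; rewrite !(ccReD, ccImD, ccReM, ccImM) /= -/x -/y; ring.
have em : expR `|x| <= expR m by rewrite ler_expR.
have e1 := expR_sub1_le x; have e2 := expR_sub1D_le x.
have ex : expR x <= expR m by rewrite ler_expR; move: xm; rewrite ler_norml; lra.
have m2 : `|y| ^+ 2 <= m ^+ 2 by rewrite ler_sqr ?nnegrE.
have x2 : `|x| ^+ 2 <= m ^+ 2 by rewrite ler_sqr ?nnegrE.
have c1 : cmod (cis y - 1 - ci R * toCC y) <= 2 * m ^+ 2.
  have := cmod_le_ReIm (cis y - 1 - ci R * toCC y).
  rewrite !(ccReD, ccImD) /= !(mul0r, mulr0, mul1r, add0r, oppr0, addr0, subr0).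
  have := cos_sub1_le2 y; have := sin_sub_le2 y; lra.
apply: (le_trans (cmodD _ _)).
apply: (le_trans (lerD (cmodD _ _) (lexx _))).
rewrite !cmodM !cmod_toCC cmod_ci mul1r.
have h1 : `|expR x - 1| <= m * expR m.
  by apply: (le_trans e1); apply: ler_pM => //; exact: expR_ge0.
have h2 : `|expR x| * cmod (cis y - 1 - ci R * toCC y) <= expR m * (2 * m ^+ 2).
  by apply: ler_pM => //; [exact: cmod_ge0 | rewrite gtr0_norm ?expR_gt0].
have h3 : `|expR x - 1 - x| <= m ^+ 2 * expR m.
  by apply: (le_trans e2); apply: ler_pM => //; exact: expR_ge0.
have h4 : `|expR x - 1| * `|y| <= (m * expR m) * m by apply: ler_pM.
by move: h4; rewrite mulrAC -expr2; lra.
Qed.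

End ComplexExponential.

(** * Sequences of geometric decay *)


Section GeometricDecay.
Context {R : realType}.
Implicit Types (a b c : nat -> CC R) (z q l p : CC R) (x s K : R).

(** Unlike mere summability, an explicit geometric bound survives multiplication by [n] and
    convolution, and gives a rate for the tails. The condition [0 < s] allows division by powers of
    [s]. *)
Definition geo b := exists K s,
  [/\ 0 <= K, 0 < s < 1 & forall n, cmod (b n) <= K * s ^+ n].

Definition bounded_seq b := exists2 K, 0 <= K & forall n, cmod (b n) <= K.

Lemma geometric_sum_le s M N : 0 < s < 1 ->
  \sum_(M <= n < N) s ^+ n <= s ^+ M / (1 - s).
Proof.
move=> /andP[s0 s1]; have d0 : 0 < 1 - s by lra.
have sM : 0 <= s ^+ M / (1 - s) by rewrite divr_ge0 ?exprn_ge0 ?ltW.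
have [NM|MN] := leqP N M; first by rewrite big_geq.
rewrite ler_pdivlMr//.
have -> : (\sum_(M <= n < N) s ^+ n) * (1 - s) = s ^+ M - s ^+ N.
  elim: N MN {sM} => // N IH; rewrite ltnS leq_eqVlt => /predU1P[<-|MN].
    by rewrite big_nat1 exprSr; ring.
  by rewrite big_nat_recr ?(ltnW MN)//= mulrDl IH// exprSr; ring.
by rewrite lerBlDr lerDl exprn_ge0 ?ltW.
Qed.

Lemma geo_bounded b : geo b -> bounded_seq b.
Proof.
move=> [K [s [K0 /andP[s0 s1] h]]]; exists K => // n.
apply: (le_trans (h n)); rewrite ler_piMr//.
by rewrite exprn_ile1 ?ltW.
Qed.

Lemma geoX q : cmod q < 1 -> geo (fun n => q ^+ n).
Proof.
move=> q1; have q0 := cmod_ge0 q.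
(* The ratio [cmod q] itself could be 0. *)
exists 1, ((1 + cmod q) / 2); split => //; first by apply/andP; split; lra.
by move=> n; rewrite mul1r cmodX lerXn2r ?nnegrE//; lra.
Qed.

Lemma geo_le b a x : (forall n, cmod (a n) <= x * cmod (b n)) -> geo b -> geo a.
Proof.
move=> ab [K [s [K0 s01 h]]]; exists (`|x| * K), s; split => //.
  by rewrite mulr_ge0.
move=> n; apply: (le_trans (ab n)); rewrite -mulrA.
apply: (@le_trans _ _ (`|x| * cmod (b n))).
  by rewrite ler_wpM2r ?cmod_ge0 ?ler_norm.
by rewrite ler_wpM2l.
Qed.

Lemma geoM_bounded b c : geo b -> bounded_seq c -> geo (fun n => b n * c n).
Proof.
move=> gb [B B0 cB]; apply: (@geo_le b _ B) gb => n.
by rewrite cmodM mulrC ler_wpM2r ?cmod_ge0.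
Qed.

Lemma geo_common a b : geo a -> geo b -> exists K s,
  [/\ 0 <= K, 0 < s < 1, forall n, cmod (a n) <= K * s ^+ n
    & forall n, cmod (b n) <= K * s ^+ n].
Proof.
move=> [K [s [K0 /andP[s0 s1] h]]] [L [t [L0 /andP[t0 t1] k]]].
have m1 : s <= Num.max s t by rewrite le_max lexx.
have m2 : t <= Num.max s t by rewrite le_max lexx orbT.
exists (K + L), (Num.max s t); split; first by rewrite addr_ge0.
- by rewrite lt_max s0 gt_max s1.
- move=> n; apply: (le_trans (h n)); apply: ler_pM => //.
  + by rewrite exprn_ge0 ?ltW.
  + by rewrite lerDl.
  + by rewrite lerXn2r ?nnegrE// ltW// (lt_le_trans s0).
- move=> n; apply: (le_trans (k n)); apply: ler_pM => //.
  + by rewrite exprn_ge0 ?ltW.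
  + by rewrite lerDr.
  + by rewrite lerXn2r ?nnegrE// ltW// (lt_le_trans s0).
Qed.

Lemma geoD a b : geo a -> geo b -> geo (fun n => a n + b n).
Proof.
move=> ga gb; have [K [s [K0 s01 h k]]] := geo_common ga gb.
exists (K + K), s; split => //; first by rewrite addr_ge0.
by move=> n; rewrite (le_trans (cmodD _ _))// mulrDl lerD.
Qed.

(** Each of the [n] terms [s ^+ j] with [j < n] is at least [s ^+ n]. *)
Lemma natr_geometric_le s n : 0 < s < 1 -> n%:R * s ^+ n <= (1 - s)^-1.
Proof.
move=> s01; have /andP[s0 s1] := s01.
apply: (@le_trans _ _ (\sum_(0 <= j < n) s ^+ j)).
  rewrite -[X in X%:R]subn0 mulr_natl -sumr_const_nat !big_nat.
  apply: ler_sum => j /andP[_ jn].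
  by rewrite ler_wiXn2l ?ltW// ltnW.
by have := geometric_sum_le 0 n s01; rewrite expr0 mul1r.
Qed.

Lemma geo_natM b : geo b -> geo (fun n => n%:R * b n).
Proof.
move=> [K [s [K0 /andP[s0 s1] h]]].
(* Any ratio strictly between [s] and 1 works: the factor [n] is absorbed by [(s / t) ^+ n], leaving
   [t ^+ n]. *)
pose t := (1 + s) / 2.
have t0 : 0 < t by rewrite /t; lra.
have t1 : t < 1 by rewrite /t; lra.
have st : s < t by rewrite /t; lra.
clearbody t.
have st01 : 0 < s / t < 1 by rewrite divr_gt0//= ltr_pdivrMr// mul1r.
exists (K * (1 - s / t)^-1), t; split; last 1 first.
- move=> n; rewrite cmodM cmod_nat.
  have -> : K * (1 - s / t)^-1 * t ^+ n = (K * t ^+ n) * (1 - s / t)^-1 by ring.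
  apply: (@le_trans _ _ ((K * t ^+ n) * (n%:R * (s / t) ^+ n))).
    have -> : K * t ^+ n * (n%:R * (s / t) ^+ n) = n%:R * (K * s ^+ n).
      have tn : t ^+ n != 0 by rewrite expf_neq0 ?gt_eqF.
      rewrite expr_div_n; move: (t ^+ n) (s ^+ n) (n%:R : R) tn => T S m T0.
      by field.
    by rewrite ler_wpM2l.
  apply: ler_wpM2l; last exact: natr_geometric_le.
  by rewrite mulr_ge0 ?exprn_ge0 ?(ltW t0).
- by rewrite mulr_ge0// invr_ge0; case/andP: st01; lra.
- by rewrite t0.
Qed.

Lemma geometric_cvg0 K s : 0 < s < 1 -> (K * s ^+ n) @[n --> \oo] --> (0 : R).
Proof.
move=> /andP[s0 s1]; apply: (@cvg_geometric R K s).
by rewrite gtr0_norm.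
Qed.

Lemma geo_cvg0 b : geo b -> b n @[n --> \oo] --> (0 : CC R).
Proof.
move=> [K [s [K0 s01 h]]]; apply: (cvg_cmod_le _ (geometric_cvg0 K s01)) => n.
by rewrite subr0.
Qed.

Lemma geo_cvg b l : geo (fun n => b n - l) -> b n @[n --> \oo] --> l.
Proof.
by move=> /geo_cvg0 /cvg_cmodP h; apply/cvg_cmodP; move: h; under eq_fun do rewrite subr0.
Qed.

Lemma geo_abs_series_cvg (f : nat -> R) K s : 0 < s < 1 ->
  (forall n, `|f n| <= K * s ^+ n) -> cvgn (series f).
Proof.
move=> s01 h; apply: normed_cvg.
apply: (@series_le_cvg R _ (geometric K s)) => //.
- by move=> n; exact: normr_ge0.
- move=> n /=; have := le_trans (normr_ge0 _) (h 0); rewrite expr0 mulr1 => K0.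
  by rewrite mulr_ge0// exprn_ge0//; case/andP: s01 => /ltW.
- by apply: is_cvg_geometric_series; case/andP: s01 => s0 s1; rewrite gtr0_norm.
Qed.

Lemma Re_sum (I : Type) (r : seq I) (f : I -> CC R) :
  complex.Re (\sum_(i <- r) f i) = \sum_(i <- r) complex.Re (f i).
Proof. by apply: (big_morph _ ccReD). Qed.

Lemma Im_sum (I : Type) (r : seq I) (f : I -> CC R) :
  complex.Im (\sum_(i <- r) f i) = \sum_(i <- r) complex.Im (f i).
Proof. by apply: (big_morph _ ccImD). Qed.

Lemma cvg_ReIm (u : nat -> CC R) x y :
  complex.Re (u n) @[n --> \oo] --> x -> complex.Im (u n) @[n --> \oo] --> y ->
  u n @[n --> \oo] --> (Complex x y : CC R).
Proof.
move=> ux uy.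
have d0 : (`|complex.Re (u n) - x| + `|complex.Im (u n) - y|)
    @[n --> \oo] --> (0 : R).
  rewrite -[0]addr0; apply: cvgD.
    by rewrite -(normr0 R) -(subrr x); apply: cvg_norm; apply: cvgB => //; exact: cvg_cst.
  by rewrite -(normr0 R) -(subrr y); apply: cvg_norm; apply: cvgB => //; exact: cvg_cst.
apply: (cvg_cmod_le _ d0) => n.
by apply: (le_trans (cmod_le_ReIm _)); rewrite ccReD ccImD.
Qed.

(* Absolute convergence of the real and imaginary parts stands in for the
   completeness of the complex numbers. *)
Lemma geo_series b : geo b ->
  exists l, geo (fun N => \sum_(0 <= n < N) b n - l).
Proof.
move=> [K [s [K0 s01 h]]].
have /cvg_ex[x cx] : cvgn (series (fun n => complex.Re (b n))).
  by apply: (geo_abs_series_cvg s01) => n; exact: (le_trans (cmod_Re _)).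
have /cvg_ex[y cy] : cvgn (series (fun n => complex.Im (b n))).
  by apply: (geo_abs_series_cvg s01) => n; exact: (le_trans (cmod_Im _)).
pose u N := \sum_(0 <= n < N) b n.
have ul : u N @[N --> \oo] --> (Complex x y : CC R).
  apply: cvg_ReIm.
    by under eq_fun do rewrite Re_sum; exact: cx.
  by under eq_fun do rewrite Im_sum; exact: cy.
have d0 : 0 <= 1 - s by case/andP: s01 => _ /ltW; rewrite subr_ge0.
exists (Complex x y), (K / (1 - s)), s; split => //.
  by rewrite divr_ge0.
move=> M; rewrite cmodB.
have uM : (u (N + M)%N - u M) @[N --> \oo] --> ((Complex x y : CC R) - u M).
  apply: cvgB; last exact: cvg_cst.
  by rewrite (cvg_shiftn M u).
apply: (cvg_cmod_ub uM) => N.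
rewrite /u (big_cat_nat (leq0n M) (leq_addl N M))/=.
rewrite addrAC subrr add0r (le_trans (cmod_sum _ _ _))//.
apply: (@le_trans _ _ (K * \sum_(M <= n < N + M) s ^+ n)).
  by rewrite mulr_sumr ler_sum.
rewrite mulrAC -mulrA ler_wpM2l//; exact: geometric_sum_le.
Qed.

Lemma cmod_sum_le b K s N : 0 <= K -> 0 < s < 1 ->
  (forall n, cmod (b n) <= K * s ^+ n) ->
  \sum_(0 <= n < N) cmod (b n) <= K / (1 - s).
Proof.
move=> K0 s01 h; apply: (@le_trans _ _ (K * \sum_(0 <= n < N) s ^+ n)).
  by rewrite mulr_sumr ler_sum.
rewrite ler_wpM2l// (le_trans (geometric_sum_le 0 N s01))//.
by rewrite expr0 mul1r.
Qed.

Lemma cmod_prod1D_le b N :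
  cmod (\prod_(0 <= n < N) (1 + b n)) <= expR (\sum_(0 <= n < N) cmod (b n)).
Proof.
rewrite cmod_prod expR_sum; apply: ler_prod => n _; rewrite cmod_ge0/=.
by rewrite (le_trans (cmodD _ _))// cmod1 expR_ge1Dx.
Qed.

Lemma geo_prod_bounded b : geo b ->
  bounded_seq (fun N => \prod_(0 <= n < N) (1 + b n)).
Proof.
move=> [K [s [K0 s01 h]]]; exists (expR (K / (1 - s))) => [|N].
  exact: expR_ge0.
by rewrite (le_trans (cmod_prod1D_le b N))// ler_expR cmod_sum_le.
Qed.

(** Consecutive partial products differ by [b n] times a bounded factor, so the product telescopes
    into a series of geometric decay. *)
Lemma geo_prod b : geo b ->
  exists p, geo (fun N => \prod_(0 <= n < N) (1 + b n) - p).
Proof.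
move=> gb; pose p N := \prod_(0 <= n < N) (1 + b n).
have [l hl] := geo_series (geoM_bounded gb (geo_prod_bounded gb)).
exists (1 + l); rewrite (_ : (fun N => _) = (fun N =>
  \sum_(0 <= n < N) b n * p n - l)) //; apply/funext => N.
suff : p N = 1 + \sum_(0 <= n < N) b n * p n by rewrite /p => ->; ring.
elim: N => [|N IH]; first by rewrite /p !big_geq// addr0.
by rewrite {1}/p big_nat_recr//= -/(p N) big_nat_recr//= addrA -IH; ring.
Qed.

Lemma cvg_bounded_seq b l : b n @[n --> \oo] --> l -> bounded_seq b.
Proof.
move=> /cvg_cmod cb.
have : cvgn (fun n => cmod (b n)) by apply/cvg_ex; eexists; exact: cb.
move=> /cvg_seq_bounded [M [_ hM]]; exists (`|M| + 1) => [|n].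
  by rewrite addr_ge0.
have MM : M < `|M| + 1 by rewrite (le_lt_trans (ler_norm _))// ltrDl.
by have := hM _ MM n I; rewrite /= (ger0_norm (cmod_ge0 _)).
Qed.

Lemma geo_inv_bounded b : geo b -> (forall n, 1 + b n != 0) ->
  bounded_seq (fun n => (1 + b n)^-1).
Proof.
move=> gb nz; apply: (@cvg_bounded_seq _ (1 + 0)^-1).
apply: cvgV; first by rewrite addr0 oner_eq0.
by apply: cvgD; [exact: cvg_cst | exact: geo_cvg0].
Qed.

(** The inverse factors are again of the form [1 + c n] with [geo c]. Their product therefore
    converges too, and the two limits multiply to 1. *)
Lemma geo_prod_neq0 b p : geo b -> (forall n, 1 + b n != 0) ->
  \prod_(0 <= n < N) (1 + b n) @[N --> \oo] --> p -> p != 0.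
Proof.
move=> gb nz cp.
pose c n := b n * - (1 + b n)^-1.
have gc : geo c.
  apply: geoM_bounded => //; case: (geo_inv_bounded gb nz) => K K0 h.
  by exists K => // n; rewrite cmodN.
have [p' /geo_cvg cp'] := geo_prod gc.
have : (\prod_(0 <= n < N) (1 + b n) * \prod_(0 <= n < N) (1 + c n))
    @[N --> \oo] --> p * p' := cvgM cp cp'.
under eq_fun => N.
  rewrite -big_split/= big1 => [|n _].
    over.
  have -> : 1 + c n = (1 + b n)^-1 by rewrite /c; field; exact: nz.
  by rewrite mulfV.
move=> h; have pp : p * p' = 1.
  by rewrite -(cvg_lim (@norm_hausdorff _ _) (h _)) ?lim_cst//; exact: norm_hausdorff.
apply: contraTneq (oner_neq0 (CC R)) => p0; rewrite negbK.
by rewrite -pp p0 mul0r.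
Qed.

(* The terms are dominated by s^n s^(N - n) = s^N. *)
Lemma geo_convolution b (d : nat -> nat -> CC R) K s : geo b ->
  0 <= K -> 0 < s < 1 ->
  (forall N n, (n <= N)%N -> cmod (d N n) <= K * s ^+ (N - n)) ->
  geo (fun N => \sum_(0 <= n < N.+1) b n * d N n).
Proof.
move=> gb K0 s01 hd.
have gK : geo (fun n => toCC (K * s ^+ n)).
  exists K, s; split => // n; rewrite cmod_toCC ger0_norm// mulr_ge0// exprn_ge0//.
  by case/andP: s01 => /ltW.
have [L [t [L0 t01 hb ht]]] := geo_common gb gK.
have /andP[t0 t1] := t01.
have gt : geo (fun N => N%:R * toCC (t ^+ N) + toCC (t ^+ N)).
  have g : geo (fun N => toCC (t ^+ N)).
    by exists 1, t; split => // n; rewrite cmod_toCC mul1r ger0_norm ?exprn_ge0 ?(ltW t0).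
  by apply: geoD => //; exact: geo_natM.
apply: (@geo_le _ _ (L * L) _ gt) => N.
apply: (le_trans (cmod_sum _ _ _)).
apply: (@le_trans _ _ (\sum_(0 <= n < N.+1) L * L * t ^+ N)).
  rewrite !big_nat; apply: ler_sum => n /andP[_]; rewrite ltnS => nN.
  rewrite cmodM.
  have -> : L * L * t ^+ N = (L * t ^+ n) * (L * t ^+ (N - n)).
    by rewrite -{1}(subnKC nN) exprD; ring.
  apply: ler_pM; rewrite ?cmod_ge0//.
  apply: (le_trans (hd _ _ nN)); have := ht (N - n)%N.
  by rewrite cmod_toCC => /(le_trans (ler_norm _)).
rewrite sumr_const_nat subn0 -[_ *+ N.+1]mulr_natr.
have -> : N%:R * toCC (t ^+ N) + toCC (t ^+ N) = toCC (N.+1%:R * t ^+ N).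
  by rewrite toCCM toCCn -natr1; ring.
rewrite cmod_toCC ger0_norm ?mulr_ge0 ?exprn_ge0 ?(ltW t0)//.
by rewrite -!mulrA [t ^+ N * _]mulrC.
Qed.

End GeometricDecay.

(** * Logarithmic derivatives of infinite products *)


Section ProductDerivative.
Context {R : realType}.
Implicit Types (b g s : nat -> CC R) (z h A : CC R) (r K : R) (F : CC R -> CC R).

(** A quadratic bound with fixed [r] and [K] is stable under pointwise limits of functions; it takes
    the place of uniform convergence of derivatives. *)
Lemma is_derive_second_order F z A r K : 0 < r ->
  (forall h, cmod h <= r ->
    cmod (F (h + z) - F z - h * A) <= K * cmod h ^+ 2) ->
  is_derive z 1 F A.
Proof.
move=> r0 hF.
have lim_quot : h^-1 *: ((F \o shift z) (h *: (1 : CC R)) - F z) @[h --> (0 : CC R)^'] --> A.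
  apply/cvg_cmodP/cvgrPdist_le => e e0.
  pose d := Num.min r (e / (`|K| + 1)).
  have d0 : 0 < d by rewrite lt_min r0 divr_gt0// ltr_pwDr.
  near=> h.
  have h0 : h != 0 by near: h; exact: nbhs_dnbhs_neq.
  have : `|h| < toCC d by near: h; apply: dnbhs0_lt; rewrite ltcR.
  move=> /ltW; rewrite cmodE toCC_ler le_min => /andP[hr he].
  have m0 : 0 < cmod h by rewrite cmod_gt0.
  rewrite sub0r normrN ger0_norm ?cmod_ge0//=.
  have -> : h^-1 *: (F (h *: 1 + z) - F z) - A
      = h^-1 * (F (h + z) - F z - h * A).
    rewrite (_ : h *: (1 : CC R) = h); last by rewrite /GRing.scale/= mulr1.
    by rewrite /GRing.scale/= [RHS]mulrBr mulKf.
  rewrite cmodM cmodV mulrC ler_pdivrMr//.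
  apply: (le_trans (hF h hr)).
  apply: (@le_trans _ _ ((`|K| + 1) * cmod h ^+ 2)).
    by rewrite ler_wpM2r ?sqr_ge0// (le_trans (ler_norm _))// lerDl.
  rewrite expr2 mulrA ler_wpM2r ?cmod_ge0//.
  by rewrite -ler_pdivlMl ?ltr_pwDr// mulrC.
split; last exact: (cvg_lim _ lim_quot).
by apply/cvg_ex; exists A.
Unshelve. all: by end_near. Qed.

Lemma cmod_prod1D_sub1_le b N :
  cmod (\prod_(0 <= n < N) (1 + b n) - 1)
    <= \prod_(0 <= n < N) (1 + cmod (b n)) - 1.
Proof.
elim: N => [|N IH]; first by rewrite !big_geq// !subrr cmod0.
rewrite !big_nat_recr//=; set p := \prod_(0 <= n < N) (1 + b n) in IH *.
set P := \prod_(0 <= n < N) (1 + cmod (b n)) in IH *.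
have -> : p * (1 + b N) - 1 = p - 1 + p * b N by ring.
have pP : cmod p <= P.
  rewrite /p cmod_prod; apply: ler_prod => n _; rewrite cmod_ge0/=.
  by rewrite (le_trans (cmodD _ _))// cmod1.
apply: (le_trans (cmodD _ _)).
have : cmod (p * b N) <= P * cmod (b N) by rewrite cmodM ler_wpM2r ?cmod_ge0.
lra.
Qed.

(** In the expanded product, the terms of degree at least 2 are dominated by those formed with the
    moduli, and these by the corresponding tail of [expR S]. *)
Lemma cmod_prod1D_sub1D_le b N (S := \sum_(0 <= n < N) cmod (b n)) :
  cmod (\prod_(0 <= n < N) (1 + b n) - 1 - \sum_(0 <= n < N) b n)
    <= S ^+ 2 * expR S.
Proof.
have S0 : 0 <= S by apply: sumr_ge0 => n _; exact: cmod_ge0.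
apply: (@le_trans _ _ (expR S - 1 - S)); last first.
  have := expR_sub1D_le S; rewrite (ger0_norm S0); apply: le_trans.
  exact: ler_norm.
apply: (@le_trans _ _ (\prod_(0 <= n < N) (1 + cmod (b n)) - 1 - S)); last first.
  rewrite !lerD2r /S expR_sum; apply: ler_prod => n _.
  by rewrite addr_ge0 ?cmod_ge0//= expR_ge1Dx.
clear S0; rewrite {}/S; elim: N => [|N IH].
  by rewrite !big_geq// !subrr cmod0.
have := cmod_prod1D_sub1_le b N.
rewrite !big_nat_recr//=.
set p := \prod_(0 <= n < N) (1 + b n) in IH *.
set P := \prod_(0 <= n < N) (1 + cmod (b n)) in IH *.
move=> pP.
have -> : p * (1 + b N) - 1 - (\sum_(0 <= n < N) b n + b N)
  = (p - 1 - \sum_(0 <= n < N) b n) + (p - 1) * b N by ring.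
apply: (le_trans (cmodD _ _)).
have : cmod ((p - 1) * b N) <= (P - 1) * cmod (b N).
  by rewrite cmodM ler_wpM2r ?cmod_ge0.
lra.
Qed.

Lemma expR_ge_sqr x : 0 <= x -> x ^+ 2 <= 2 * expR x :> R.
Proof. by move=> x0; have := expR_ge1Dxn 1 x0; rewrite -[2`!]/2%N; lra. Qed.

Lemma expR_ge_id (x : R) : x <= expR x.
Proof. by have := expR_ge1Dx x; lra. Qed.

Lemma expR_2M (x : R) : expR (2 * x) = expR x * expR x.
Proof. by rewrite -expRD; congr expR; ring. Qed.

(** The dependence on [h] is isolated in [cmod h / r <= 1], and all growth in [a] goes into one
    exponential weight, the one that reappears in the hypothesis [gs] below. *)
Lemma cexp_sub1_scaled r (a h : CC R) : 0 < r -> cmod h <= r ->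
  cmod (cexp (a * h) - 1) <= 3 * (cmod h / r) * expR (2 * (r * cmod a)).
Proof.
move=> r0 hr; apply: (le_trans (cmod_cexp_sub1 _)).
rewrite cmodM -[leRHS]mulrA ler_wpM2l//.
have -> : cmod a * cmod h = (cmod h / r) * (r * cmod a) by field; rewrite gt_eqF.
rewrite -[leLHS]mulrA ler_wpM2l ?divr_ge0 ?cmod_ge0 ?(ltW r0)//.
rewrite expR_2M; apply: ler_pM; rewrite ?expR_ge0 ?expR_ge_id//.
  by rewrite mulr_ge0 ?cmod_ge0 ?(ltW r0).
rewrite ler_expR ler_piMl ?mulr_ge0 ?cmod_ge0 ?(ltW r0)//.
by rewrite ler_pdivrMr// mul1r.
Qed.

Lemma cexp_sub1D_scaled r (a h : CC R) : 0 < r -> cmod h <= r ->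
  cmod (cexp (a * h) - 1 - a * h)
    <= 8 * (cmod h / r) ^+ 2 * expR (2 * (r * cmod a)).
Proof.
move=> r0 hr; apply: (le_trans (cmod_cexp_sub1D _)).
have -> : cmod (a * h) = (cmod h / r) * (r * cmod a).
  by rewrite cmodM; field; rewrite gt_eqF.
set y := cmod h / r; set x := r * cmod a.
have x0 : 0 <= x by rewrite mulr_ge0 ?cmod_ge0 ?(ltW r0).
have y0 : 0 <= y by rewrite divr_ge0 ?cmod_ge0 ?(ltW r0).
have y1 : y <= 1 by rewrite ler_pdivrMr// mul1r.
rewrite exprMn expR_2M.
have -> : 8 * y ^+ 2 * (expR x * expR x) = 4 * (y ^+ 2 * (2 * expR x) * expR x).
  by ring.
rewrite ler_wpM2l//; apply: ler_pM; rewrite ?expR_ge0//.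
- by rewrite mulr_ge0 ?sqr_ge0.
- by rewrite ler_wpM2l ?sqr_ge0// expR_ge_sqr.
- by rewrite ler_expR ler_piMl.
Qed.

Section ExponentialFactors.
Variables (g s : nat -> CC R) (z : CC R) (r : R).
Let term n t := g n * cexp (s n * t).
Hypotheses (r0 : 0 < r)
  (gs : geo (fun n => term n z * toCC (expR (2 * (r * cmod (s n))))))
  (nz : forall n, 1 + term n z != 0).

(** A shift by [h] costs at most [expR (r * cmod (s n))], which the weight in [gs] covers. The other
    half of the weight absorbs powers of [s n]. *)
Lemma geo_exp_factor h : cmod h <= r -> geo (fun n => term n (h + z)).
Proof.
move=> hr; apply: (@geo_le _ _ _ 1 _ gs) => n.
rewrite mul1r /term mulrDr cexpD !cmodM cmod_toCC !(ger0_norm (expR_ge0 _)).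
rewrite [leLHS]mulrCA [leLHS]mulrC ler_wpM2l ?mulr_ge0 ?cmod_ge0//.
rewrite cmod_cexp ler_expR.
apply: (le_trans (ler_norm _)); apply: (le_trans (cmod_Re _)).
rewrite cmodM mulrCA; have := cmod_ge0 (s n); have := cmod_ge0 h; nra.
Qed.

Lemma prod_exp_factor_cvg h : cmod h <= r ->
  \prod_(0 <= n < N) (1 + term n (h + z)) @[N --> \oo]
    --> limn (fun N => \prod_(0 <= n < N) (1 + term n (h + z))).
Proof.
move=> hr; have [p /geo_cvg cp] := geo_prod (geo_exp_factor hr).
by apply/cvg_ex; exists p.
Qed.

(** The factors at [h + z] are those at [z] times [1 + x n], with [x n] equal to [h * (s n * p n)]
    up to second order. The product of the [1 + x n] is thus 1 plus [h] times a partial sum of [A],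
    with a quadratic error uniform in [N]. *)
Lemma is_derive_prod_exp
    (F := fun t => limn (fun N => \prod_(0 <= n < N) (1 + term n t))) :
  exists A, [/\ F z != 0,
    \sum_(0 <= n < N) s n * (term n z / (1 + term n z)) @[N --> \oo] --> A
    & is_derive z 1 F (F z * A)].
Proof.
have r00 : cmod (0 : CC R) <= r by rewrite cmod0 ltW.
have gz := geo_exp_factor r00; rewrite add0r in gz.
have cz := prod_exp_factor_cvg r00; rewrite add0r -/(F z) in cz.
pose p n := term n z / (1 + term n z).
pose e n := expR (2 * (r * cmod (s n))).
have gp : geo (fun n => p n * toCC (e n)).
  have := geoM_bounded gs (geo_inv_bounded gz nz).
  by apply: (@geo_le _ _ _ 1) => n; rewrite mul1r /p mulrAC.
have gsp : geo (fun n => s n * p n).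
  apply: (@geo_le _ _ _ r^-1 _ gp) => n.
  rewrite !cmodM cmod_toCC (ger0_norm (expR_ge0 _)) [leRHS]mulrCA [leLHS]mulrC.
  rewrite ler_wpM2l ?mulr_ge0 ?cmod_ge0//.
  rewrite ler_pdivlMl// /e expR_2M.
  have := expR_ge_id (r * cmod (s n)).
  have : 1 <= expR (r * cmod (s n)).
    by rewrite -expR0 ler_expR mulr_ge0 ?cmod_ge0 ?(ltW r0).
  nra.
have [A gA] := geo_series gsp; have cA := geo_cvg gA.
exists A; split; [exact: geo_prod_neq0 gz nz cz | exact: cA |].
have [K [q [K0 q01 hp]]] := gp.
have [M M0 hM] := geo_prod_bounded gz.
have q0 : 0 < 1 - q by case/andP: q01 => _; rewrite subr_gt0.
(* [B * y] will bound the sum of the [cmod (x n)]. In [C], the first summand is the error of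
   linearizing the product, the second that of linearizing the exponentials. *)
pose B := 3 * K / (1 - q).
pose C := B ^+ 2 * expR B + 8 * K / (1 - q).
have B0 : 0 <= B by rewrite /B divr_ge0 ?mulr_ge0 ?(ltW q0).
apply: (@is_derive_second_order _ _ _ r (M * (C / r ^+ 2)) r0) => h hr.
pose x n := p n * (cexp (s n * h) - 1).
pose y := cmod h / r.
have y0 : 0 <= y by rewrite divr_ge0 ?cmod_ge0 ?(ltW r0).
have y1 : y <= 1 by rewrite ler_pdivrMr// mul1r.
have pe n : cmod (p n) * e n <= K * q ^+ n.
  by have := hp n; rewrite cmodM cmod_toCC (ger0_norm (expR_ge0 _)).
have factor n : 1 + term n (h + z) = (1 + term n z) * (1 + x n).
  rewrite /x /p /term mulrDr cexpD; field; exact: nz.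
have x_le n : cmod (x n) <= 3 * K * y * q ^+ n.
  rewrite /x cmodM; apply: (@le_trans _ _ (cmod (p n) * (3 * y * e n))).
    by rewrite ler_wpM2l ?cmod_ge0// cexp_sub1_scaled.
  by have := pe n; nra.
have x_le2 n : cmod (x n - h * (s n * p n)) <= 8 * K * y ^+ 2 * q ^+ n.
  have -> : x n - h * (s n * p n) = p n * (cexp (s n * h) - 1 - s n * h).
    by rewrite /x; ring.
  rewrite cmodM; apply: (@le_trans _ _ (cmod (p n) * (8 * y ^+ 2 * e n))).
    by rewrite ler_wpM2l ?cmod_ge0// cexp_sub1D_scaled.
  by have := pe n; have := sqr_ge0 y; nra.
have approx N : cmod (\prod_(0 <= n < N) (1 + x n) - 1
    - h * \sum_(0 <= n < N) s n * p n) <= C * y ^+ 2.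
  have S_le : \sum_(0 <= n < N) cmod (x n) <= B * y.
    have := @cmod_sum_le _ x _ _ N _ q01 x_le.
    have -> : 3 * K * y / (1 - q) = B * y by rewrite /B; ring.
    by apply; apply: mulr_ge0 => //; exact: mulr_ge0.
  set S := \sum_(0 <= n < N) cmod (x n) in S_le.
  have S0 : 0 <= S by apply: sumr_ge0 => n _; exact: cmod_ge0.
  have -> : \prod_(0 <= n < N) (1 + x n) - 1 - h * \sum_(0 <= n < N) s n * p n
    = (\prod_(0 <= n < N) (1 + x n) - 1 - \sum_(0 <= n < N) x n)
      + \sum_(0 <= n < N) (x n - h * (s n * p n)).
    by rewrite sumrB -mulr_sumr; ring.
  apply: (le_trans (cmodD _ _)); rewrite /C mulrDl lerD//.
    apply: (le_trans (cmod_prod1D_sub1D_le x N)); rewrite -/S.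
    rewrite (_ : _ * y ^+ 2 = (B * y) ^+ 2 * expR B); last by ring.
    apply: ler_pM; rewrite ?sqr_ge0 ?expR_ge0//.
      by rewrite lerXn2r ?nnegrE// mulr_ge0.
    rewrite ler_expR (le_trans S_le)//; nra.
  apply: (le_trans (cmod_sum _ _ _)).
  have := @cmod_sum_le _ _ _ _ N _ q01 x_le2.
  have -> : 8 * K * y ^+ 2 / (1 - q) = 8 * K / (1 - q) * y ^+ 2 by ring.
  by apply; apply: mulr_ge0; [exact: mulr_ge0|exact: sqr_ge0].
have -> : M * (C / r ^+ 2) * cmod h ^+ 2 = M * (C * y ^+ 2).
  by rewrite /y expr_div_n; field; rewrite gt_eqF.
have -> : h * (F z * A) = F z * (h * A) by ring.
(* The remainder is the limit of its finite versions, so it suffices to bound those for each [N]. *)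
have lim_diff : (\prod_(0 <= n < N) (1 + term n (h + z))
    - \prod_(0 <= n < N) (1 + term n z)
    - \prod_(0 <= n < N) (1 + term n z) * (h * \sum_(0 <= n < N) s n * p n))
    @[N --> \oo] --> F (h + z) - F z - F z * (h * A).
  apply: cvgB; first exact: (cvgB (prod_exp_factor_cvg hr) cz).
  exact: (cvgM cz (cvgM (cvg_cst h) cA)).
apply: (cvg_cmod_ub lim_diff) => N.
under eq_bigr do rewrite factor.
rewrite big_split/=.
set P := \prod_(0 <= n < N) (1 + term n z).
set X := \prod_(0 <= n < N) (1 + x n).
set T := h * _.
have -> : P * X - P - P * T = P * (X - 1 - T) by ring.
rewrite cmodM; apply: ler_pM; rewrite ?cmod_ge0//; first exact: hM.
exact: approx.
Qed.

End ExponentialFactors.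
End ProductDerivative.

(** * Finite identities *)


Section QBinomial.
Variables (F : fieldType) (q : F).
Hypothesis q1 : forall j, 1 - q ^+ j.+1 != 0.

(** The q-Pochhammer symbol (q; q)_n. The powers of 1 - q that separate it from the q-factorial
    cancel in q-binomial coefficients. *)
Definition qfact n := \prod_(0 <= j < n) (1 - q ^+ j.+1).

Lemma qfactS n : qfact n.+1 = qfact n * (1 - q ^+ n.+1).
Proof. by rewrite /qfact big_nat_recr. Qed.

Lemma qfact_neq0 n : qfact n != 0.
Proof.
elim: n => [|n IH]; first by rewrite /qfact big_geq// oner_eq0.
by rewrite qfactS mulf_neq0.
Qed.

Lemma qbinomial_pascal M s : (s < M)%N ->
  qfact M.+1 / (qfact s.+1 * qfact (M.+1 - s.+1))
  = qfact M / (qfact s.+1 * qfact (M - s.+1))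
    + q ^+ (M - s) * (qfact M / (qfact s * qfact (M - s))).
Proof.
move=> sM; rewrite subSS -(subnSK sM).
have qM : q ^+ M.+1 = q ^+ (M - s.+1).+1 * q ^+ s.+1.
  by rewrite -exprD; congr (_ ^+ _); lia.
move: (q1 s) (q1 (M - s.+1)) (qfact_neq0 s) (qfact_neq0 (M - s.+1)).
rewrite !qfactS qM.
move: (qfact s) (qfact (M - s.+1)) (qfact M) (q ^+ s.+1) (q ^+ (M - s.+1).+1).
by move=> a b c u v h1 h2 h3 h4; field; rewrite h1 h2 h3 h4.
Qed.

Lemma qbinomial_theorem y M : \prod_(0 <= j < M) (1 + y * q ^+ j)
  = \sum_(0 <= s < M.+1)
      qfact M / (qfact s * qfact (M - s)) * q ^+ 'C(s, 2) * y ^+ s.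
Proof.
have q00 : qfact 0 = 1 by rewrite /qfact big_geq.
elim: M => [|M IH].
  by rewrite big_geq// big_nat1 subnn q00 bin0n !(expr0, mulr1, invr1).
rewrite big_nat_recr//= IH mulrDr mulr1.
rewrite [RHS]big_nat_recl// [X in _ = _ + X]big_nat_recr//=.
rewrite [X in X + _ = _]big_nat_recl// [X in _ + X * _ = _]big_nat_recr//=.
rewrite mulrDl mulr_suml !subn0 !subnn q00 !mul1r !mulr1.
rewrite !divff ?qfact_neq0// !(bin0n, expr0, mul1r, mulr1).
rewrite (_ : q ^+ 'C(M, 2) * y ^+ M * (y * q ^+ M)
  = q ^+ 'C(M.+1, 2) * y ^+ M.+1); last first.
  by rewrite binS bin1 exprD exprS; ring.
rewrite -!addrA; congr (_ + _); rewrite addrA; congr (_ + _).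
rewrite -big_split/=; apply: eq_big_nat => s /andP[_ sM].
rewrite qbinomial_pascal// [in RHS]mulrDl [in RHS]mulrDl; congr (_ + _).
have -> : q ^+ 'C(s.+1, 2) = q ^+ 'C(s, 2) * q ^+ s.
  by rewrite binS bin1 exprD.
have -> : q ^+ M = q ^+ (M - s) * q ^+ s by rewrite -exprD subnK// ltnW.
by rewrite exprS; ring.
Qed.

Lemma expf_divE (w : F) a b c d : w != 0 -> (a + d = c + b)%N ->
  w ^+ a / w ^+ b = w ^+ c / w ^+ d.
Proof.
move=> w0 e; have [wb wd] := (expf_neq0 b w0, expf_neq0 d w0).
by apply: (mulIf wb); apply: (mulIf wd); rewrite mulfVK// mulrAC mulfVK// -!exprD e.
Qed.

Lemma bin2D a b : 'C(a + b, 2) = ('C(a, 2) + 'C(b, 2) + a * b)%N.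
Proof.
elim: b => [|b IH]; first by rewrite addn0 bin0n; lia.
by rewrite addnS !binS !bin1 IH; lia.
Qed.

Lemma bin2_double a : ('C(a, 2) * 2 + a = a * a)%N.
Proof. by elim: a => // a IH; rewrite binS bin1; lia. Qed.

(** This is the q-binomial theorem with 2 N factors at y = w q^(1 - N). The first N factors,
    reversed, are w q^(-j) (1 + q^j/w); pulling out the w q^(-j) produces [D]. The summation index
    is recentred at N. *)
Lemma finite_triple_product w N : q != 0 -> w != 0 ->
  (\prod_(0 <= j < N) (1 + q ^+ j.+1 * w)) * (\prod_(0 <= j < N) (1 + q ^+ j / w))
  = \sum_(0 <= n < N.+1) q ^+ 'C(n.+1, 2) * w ^+ n
      * (qfact (N + N) / (qfact (N + n) * qfact (N - n)))
  + \sum_(0 <= n < N) q ^+ 'C(n.+1, 2) / w ^+ n.+1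
      * (qfact (N + N) / (qfact (N + n.+1) * qfact (N - n.+1))).
Proof.
move=> q0 w0.
have qn0 n : q ^+ n != 0 by rewrite expf_neq0.
have wn0 n : w ^+ n != 0 by rewrite expf_neq0.
have := qbinomial_theorem (w * q / q ^+ N) (N + N).
rewrite (big_cat_nat (leq0n N) (leq_addr N N))/=.
rewrite big_nat_rev/= add0n.
rewrite (eq_big_nat _ _ (F2 := fun j => w / q ^+ j * (1 + q ^+ j / w))); last first.
  move=> j /andP[_ jN].
  have -> : q ^+ N = q ^+ j * q * q ^+ (N - j.+1).
    by rewrite -exprSr -exprD; congr (_ ^+ _); lia.
  have := qn0 j; have := qn0 (N - j.+1)%N.
  by move: (q ^+ j) (q ^+ (N - j.+1)) => a b b0 a0; field; rewrite w0 q0 a0 b0.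
rewrite big_split/=.
have -> : \prod_(0 <= j < N) (w / q ^+ j) = w ^+ N / q ^+ 'C(N, 2).
  elim: N => [|N IH]; first by rewrite big_geq// !expr0 invr1 mulr1.
  rewrite big_nat_recr//= IH binS bin1 exprD exprSr.
  by have := qn0 N; have := qn0 'C(N, 2); move=> ? ?; field; apply/andP.
have -> : \prod_(N <= j < N + N) (1 + w * q / q ^+ N * q ^+ j)
    = \prod_(0 <= j < N) (1 + q ^+ j.+1 * w).
  rewrite -[X in \prod_(X <= _ < _) _]add0n big_addn addnK.
  apply: eq_big_nat => j _; rewrite exprD exprS; have := qn0 N.
  by move: (q ^+ N) => a a0; field.
rewrite -[(N + N).+1]addnS (big_cat_nat (leq0n N) (leq_addr N.+1 N))/=.
rewrite [X in _ = X + _]big_nat_rev/= add0n.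
rewrite -[X in _ = _ + \sum_(X <= _ < _) _]add0n big_addn addKn.
set P := \prod_(0 <= j < N) (1 + q ^+ j.+1 * w).
set Q := \prod_(0 <= j < N) (1 + q ^+ j / w) => h.
pose D := w ^+ N / q ^+ 'C(N, 2).
have D0 : D != 0 by rewrite mulf_neq0// invr_neq0.
apply: (mulfI D0); rewrite -/D in h; have -> : D * (P * Q) = D * Q * P by ring.
rewrite [RHS]mulrDr [RHS]addrC h !mulr_sumr; congr (_ + _).
  apply: eq_big_nat => n /andP[_ nN].
  have -> : (N + N - (N - n.+1) = N + n.+1)%N by lia.
  have E1 : q ^+ ('C(N - n.+1, 2) + (N - n.+1)) / q ^+ (N * (N - n.+1))
      = q ^+ 'C(n.+1, 2) / q ^+ 'C(N, 2).
    apply: expf_divE => //; move: (subnK nN); set s := (N - n.+1)%N => eN.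
    by rewrite -{}eN bin2D; have := bin2_double s; nia.
  have E2 : w ^+ N = w ^+ (N - n.+1) * w ^+ n.+1 by rewrite -exprD subnK.
  rewrite /D E2 !exprMn exprVn -exprM.
  rewrite exprD in E1.
  rewrite [RHS](_ : _ = w ^+ (N - n.+1) * (q ^+ 'C(n.+1, 2) / q ^+ 'C(N, 2))
    * (qfact (N + N) / (qfact (N + n.+1) * qfact (N - n.+1)))
    * (w ^+ n.+1 / w ^+ n.+1)); last by ring.
  by rewrite -E1 divff// [qfact (N + n.+1) * _]mulrC; ring.
apply: eq_big_nat => n /andP[_ nN].
have -> : (N + N - (n + N) = N - n)%N by lia.
have E1 : q ^+ ('C(n + N, 2) + (n + N)) / q ^+ (N * (n + N))
    = q ^+ 'C(n.+1, 2) / q ^+ 'C(N, 2).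
  apply: expf_divE => //.
  by rewrite bin2D binS bin1; have := bin2_double N; nia.
rewrite /D !exprMn exprVn -exprM [w ^+ (n + N)]exprD.
rewrite exprD in E1.
rewrite [RHS](_ : _ = w ^+ n * w ^+ N * (q ^+ 'C(n.+1, 2) / q ^+ 'C(N, 2))
    * (qfact (N + N) / (qfact (N + n) * qfact (N - n)))); last by ring.
by rewrite -E1 [(n + N)%N]addnC; ring.
Qed.

End QBinomial.

(** The u_m of the overview at [x], its v_m at [x^-1], and the Lambert term q^m/(1 - q^m) at 1. *)
Definition lambert (F : fieldType) (q x : F) m := q ^+ m * x / (1 - q ^+ m * x).

(** * The square of a truncated cotangent series *)

Section CotangentSquare.
Variables (F : numFieldType) (q x : F).
Hypotheses (x0 : x != 0) (ux : forall m, 1 - q ^+ m * x != 0)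
  (vx : forall m, 1 - q ^+ m / x != 0) (q1 : forall m, 1 - q ^+ m.+1 != 0).
Let u := lambert q x.
Let v := lambert q x^-1.
Let e := lambert q 1.

Let vE m : v m = q ^+ m / (x - q ^+ m) /\ x - q ^+ m != 0.
Proof.
have nz : x - q ^+ m != 0.
  by apply: contraNneq (vx m) => h; rewrite -(subr0_eq h) mulfV// subrr.
split => //; rewrite /v /lambert; have := vx m.
by move: (q ^+ m) nz => a nz h; field; rewrite x0 nz.
Qed.

Let eE m : e m = q ^+ m / (1 - q ^+ m).
Proof. by rewrite /e /lambert mulr1. Qed.

(* The addition theorem of the cotangent, for the pairs of points
   q^{+-M} x and q^{+-m} x. *)
Let cross_pair m M : (0 < m < M)%N ->
  (u M - v M) * (u m - v m) = 1 - (1 + u M + v M)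
    + e (M - m) * ((1 + u m + v m) - (1 + u M + v M))
    - e (M + m) * ((1 + u m + v m) + (1 + u M + v M)).
Proof.
move=> /andP[m0 mM]; have [-> hm] := vE m; have [-> hM] := vE M.
have := ux m; have := ux M; rewrite !eE /u /lambert.
have := q1 (M - m).-1; rewrite prednK ?subn_gt0//.
have := q1 (M + m).-1; rewrite prednK ?addn_gt0 ?m0 ?orbT//.
rewrite exprD -(subnK (ltnW mM)) addnK exprD in hM *.
move: (q ^+ (M - m)) (q ^+ m) hm hM => b a h1 h2 h3 h4 h5 h6.
by field; rewrite h1 h2 h3 h4 h5 h6.
Qed.

(** The case m = 0 of the addition theorem, where the pair of points collapses to x. *)
Let cross_zero M : (0 < M)%N ->
  (u M - v M) * (2 * (1 / 2 + x / (1 - x)))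
  = 1 - (1 + u M + v M) - 2 * e M * (1 + u M + v M).
Proof.
move=> M0; have [-> hM] := vE M.
have := ux 0; have := ux M; have := q1 M.-1; rewrite prednK// expr0 mul1r.
rewrite !eE /u /lambert.
by move: (q ^+ M) hM => a h1 h2 h3 h4; field; rewrite h1 h2 h3 h4.
Qed.

(** The addition theorem for the two points q^M x and q^(-M) x of one pair. *)
Let cross_self M : (0 < M)%N -> u M * v M = (1 + u M + v M) * e (M + M).
Proof.
move=> M0; have [-> hM] := vE M.
have := ux M; have := q1 (M + M).-1; rewrite prednK ?addn_gt0 ?M0// exprD.
rewrite eE /u /lambert exprD.
by move: (q ^+ M) hM => a h1 h2 h3; field; rewrite h1 h2 h3.
Qed.

Lemma finite_cotangent_square N :
  (1 / 2 + x / (1 - x) + \sum_(1 <= m < N.+1) (u m - v m)) ^+ 2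
  = (1 / 2 + x / (1 - x)) ^+ 2
    + \sum_(1 <= m < N.+1) (u m + u m ^+ 2 + (v m + v m ^+ 2))
    - 2 * \sum_(1 <= m < N.+1) m%:R * (u m + v m)
    - 2 * \sum_(1 <= m < N.+1)
            (1 + u m + v m) * \sum_((N - m).+1 <= d < (N + m).+1) e d.
Proof.
elim: N => [|N IH]; first by rewrite !big_geq//; ring.
set M := N.+1; set A := 1 / 2 + _ in IH *.
pose G m := 1 + u m + v m.
(* From N to M = N + 1 the window of each old m loses d = M - m and gains d = M + m; [X] is the
   total change. The new window, of m = M, consists of the indices in [E] together with M and 2 M,
   and its term at 2 M accounts for the product [u M * v M] in the square. *)
pose X := \sum_(1 <= m < M) G m * (e (M - m) - e (M + m)).
pose E := \sum_(1 <= m < M) (e (M - m) + e (M + m)).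
have crossE : (u M - v M) * \sum_(1 <= m < M) (u m - v m)
    = N%:R * (1 - G M) + X - G M * E.
  have -> : N%:R * (1 - G M) = \sum_(1 <= m < M) (1 - G M).
    by rewrite sumr_const_nat subSS subn0 mulr_natl.
  rewrite /X /E !mulr_sumr -big_split -sumrB /=; apply: eq_big_nat => m mM.
  by rewrite cross_pair// /G; ring.
have epsE : \sum_(1 <= m < M) G m * \sum_((M - m).+1 <= d < (M + m).+1) e d
    = \sum_(1 <= m < M) G m * \sum_((N - m).+1 <= d < (N + m).+1) e d - X.
  rewrite /X -sumrB; apply: eq_big_nat => m /andP[m0 mM].
  rewrite -mulrBr; congr (_ * _).
  have -> : (M - m = (N - m).+1)%N by rewrite subSn.
  have -> : (M + m = (N + m).+1)%N by rewrite addSn.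
  rewrite [in LHS]big_nat_recr/=; last by lia.
  by rewrite [in RHS]big_ltn; [ring | lia].
have lastE : \sum_((M - M).+1 <= d < (M + M).+1) e d = E + e M + e (M + M).
  rewrite subnn big_nat_recr /=; last by rewrite /M; lia.
  have M1 : (1 <= M)%N by [].
  have MM : (M <= M + M)%N by lia.
  rewrite (big_cat_nat M1 MM)/= (@big_ltn _ _ _ M); last by lia.
  have -> : \sum_(M.+1 <= d < M + M) e d = \sum_(1 <= m < M) e (M + m).
    rewrite -[M.+1]add1n big_addn addnK; apply: eq_bigr => m _.
    by rewrite addnC.
  have -> : \sum_(1 <= d < M) e d = \sum_(1 <= m < M) e (M - m).
    rewrite [LHS]big_nat_rev; apply: eq_big_nat => m /andP[_ mM].
    by congr e; lia.
  by rewrite /E big_split/=; ring.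
rewrite !(@big_nat_recr _ _ _ M 1)//= -/G epsE lastE.
have -> : forall s, (A + (s + (u M - v M))) ^+ 2 = (A + s) ^+ 2 + (u M - v M) * (2 * A) + 2 * ((u M - v M) * s) + (u M - v M) ^+ 2 by move=> s; ring.
rewrite IH crossE cross_zero//.
have := @cross_self M isT; rewrite -/(G M).
have -> : M%:R = N%:R + 1 :> F by rewrite natr1.
move=> uv; have -> : G M * (E + e M + e (M + M)) = G M * (E + e M) + u M * v M.
  by rewrite uv; ring.
by rewrite /G /M /=; ring.
Qed.

End CotangentSquare.

(** * Rational functions summed over the roots of unity *)

Section RootSums.
Variables (F : numFieldType) (k : nat) (w : F).
Hypotheses (wk : k.-primitive_root w).

Let k0 : (0 < k)%N := prim_order_gt0 wk.

Lemma sum_root_expr m :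
  \sum_(0 <= j < k) (w ^+ j) ^+ m = if (k %| m)%N then k%:R else 0.
Proof.
under eq_bigr do rewrite exprAC.
have [km|km] := ifP.
  have -> : w ^+ m = 1 by apply/eqP; rewrite -(prim_order_dvd wk).
  under eq_bigr do rewrite expr1n.
  by rewrite sumr_const_nat subn0.
have wm : w ^+ m - 1 != 0 by rewrite subr_eq0 -(prim_order_dvd wk) km.
apply: (mulfI wm); rewrite big_mkord -subrX1 mulr0 exprAC.
by rewrite (prim_expr_order wk) expr1n subrr.
Qed.

Lemma root_expr j : (w ^+ j) ^+ k = 1.
Proof. by rewrite exprAC (prim_expr_order wk) expr1n. Qed.

(** For t = y w^j the denominator 1 - t^k is the same for all j, so sums over j reduce to the
    orthogonality in [sum_root_expr]. *)
Lemma inv_one_sub (t : F) : t ^+ k != 1 ->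
  (1 - t)^-1 = (\sum_(0 <= m < k) t ^+ m) / (1 - t ^+ k).
Proof.
move=> tk; have t1 : 1 - t != 0.
  by rewrite subr_eq0 eq_sym; apply: contraNneq tk => ->; rewrite expr1n.
have tk1 : 1 - t ^+ k != 0 by rewrite subr_eq0 eq_sym.
have e : 1 - t ^+ k = (1 - t) * \sum_(0 <= m < k) t ^+ m.
  by rewrite big_mkord -opprB subrX1 -mulNr opprB.
by apply: (mulfI t1); rewrite mulfV// mulrA -e mulfV.
Qed.

Lemma sum_root_geometric y : y ^+ k != 1 ->
  \sum_(0 <= j < k) y * w ^+ j / (1 - y * w ^+ j) = k%:R * (y ^+ k / (1 - y ^+ k)).
Proof.
move=> yk; have tk j : (y * w ^+ j) ^+ k = y ^+ k by rewrite exprMn root_expr mulr1.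
under eq_bigr => j _.
  rewrite inv_one_sub ?tk// mulrA mulr_sumr; over.
rewrite -mulr_suml exchange_big/= mulrA; congr (_ / _).
under eq_bigr => m _.
  under eq_bigr do rewrite -exprS exprMn.
  rewrite -mulr_sumr sum_root_expr; over.
rewrite -[in \sum_(_ <= _ < k) _](prednK k0) big_nat_recr//= prednK// dvdnn.
rewrite big_nat big1 ?add0r 1?mulrC// => m /andP[_ mk].
by rewrite gtnNdvd ?mulr0//; lia.
Qed.

Lemma sum_root_geometric2 y : y ^+ k != 1 ->
  \sum_(0 <= j < k) y * w ^+ j / (1 - y * w ^+ j) ^+ 2
  = k%:R ^+ 2 * (y ^+ k / (1 - y ^+ k) ^+ 2).
Proof.
move=> yk; have tk j : (y * w ^+ j) ^+ k = y ^+ k by rewrite exprMn root_expr mulr1.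
under eq_bigr => j _.
  rewrite -exprVn inv_one_sub ?tk// exprMn mulrA exprVn expr2.
  rewrite mulr_suml mulr_sumr.
  under eq_bigr => a _ do rewrite !mulr_sumr.
  over.
rewrite -mulr_suml exchange_big/= mulrA; congr (_ / _).
transitivity (\sum_(0 <= a < k) k%:R * y ^+ k); last first.
  by rewrite sumr_const_nat subn0 -[LHS]mulr_natl; ring.
apply: eq_big_nat => a /andP[_ ak]; rewrite exchange_big/=.
under eq_bigr => b _.
  under eq_bigr do rewrite -exprD -exprS exprMn.
  rewrite -mulr_sumr sum_root_expr; over.
rewrite big_mkord.
(* The exponent a + b + 1 lies between 1 and 2 k - 1, so k divides it for exactly one b. *)
have kak : (k - a.+1 < k)%N by lia.
rewrite (bigD1 (Ordinal kak))//= big1 ?addr0 => [|b bk].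
  have -> : (a + (k - a.+1)).+1 = k by lia.
  by rewrite dvdnn mulrC.
case: ifP => [/dvdnP[c hc]|_]; last by rewrite mulr0.
case/eqP: bk; apply: val_inj => /=; have := ltn_ord b.
by case: c hc => [|[|c]] hc bk; lia.
Qed.

(** At y = 1 the expansion above breaks down. Instead, w^j/(1 - w^j)^2 is interpolated by a
    polynomial [f] of degree below k without constant term: the sum of [f] over all roots vanishes,
    so the sum over those other than 1 is - f(1). *)
Lemma sum_root_one :
  \sum_(1 <= j < k) w ^+ j / (1 - w ^+ j) ^+ 2 = - (k%:R ^+ 2 - 1) / 12.
Proof.
pose f (t : F) := \sum_(0 <= m < k) m%:R * (k%:R - m%:R) * t ^+ m.
have kn0 : k%:R != 0 :> F by rewrite pnatr_eq0 -lt0n.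
(* The parameter [K] is separated from the length [n] so that induction on [n] goes through; both
   become k afterwards. *)
have closed (K : F) t n : (1 - t) ^+ 3 * (\sum_(0 <= m < n) m%:R * (K - m%:R) * t ^+ m)
   = t * ((K - 1) - (K + 1) * t) - t ^+ n * (n%:R * (K - n%:R) * (1 - t) ^+ 2
      + (K - 2 * n%:R) * t * (1 - t) - t * (1 + t)).
  elim: n => [|n IH].
    by rewrite big_geq// expr0 mulr0n; ring.
  by rewrite big_nat_recr//= mulrDr IH -[n.+1%:R]natr1 [t ^+ n.+1]exprS; ring.
have fE j : (0 < j < k)%N -> w ^+ j / (1 - w ^+ j) ^+ 2 = f (w ^+ j) / (2 * k%:R).
  move=> /andP[j0 jk]; have t1 : 1 - w ^+ j != 0.
    by rewrite subr_eq0 eq_sym -(prim_order_dvd wk) gtnNdvd.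
  have h : (1 - w ^+ j) ^+ 3 * f (w ^+ j) = 2 * k%:R * w ^+ j * (1 - w ^+ j).
    by rewrite /f closed root_expr; ring.
  move: (w ^+ j) t1 h => t t1; move: (f t) => S h.
  have t3 : (1 - t) ^+ 3 != 0 by rewrite expf_neq0.
  have -> : S = 2 * k%:R * t * (1 - t) / (1 - t) ^+ 3 by rewrite -h mulrC mulKf.
  by field; rewrite kn0 t1.
rewrite (eq_big_nat _ _ fE) -mulr_suml.
have sum_all : \sum_(0 <= j < k) f (w ^+ j) = 0.
  rewrite /f exchange_big/= big_nat big1 // => m /andP[_ mk].
  rewrite -mulr_sumr sum_root_expr; case: ifP => [km|_]; last by rewrite mulr0.
  by case: m mk km => [|m] mk; rewrite ?mul0r// gtnNdvd.
have f1 : f 1 = k%:R * (k%:R ^+ 2 - 1) / 6.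
  have gen (K : F) n : \sum_(0 <= m < n) m%:R * (K - m%:R) * 1 ^+ m
     = K * (n%:R * (n%:R - 1)) / 2 - (n%:R - 1) * n%:R * (2 * n%:R - 1) / 6.
    elim: n => [|n IH]; first by rewrite big_geq// mulr0n; field.
    by rewrite big_nat_recr//= IH -[n.+1%:R]natr1 expr1n; field.
  by rewrite /f gen; field.
rewrite big_ltn// expr0 f1 in sum_all.
have -> : \sum_(1 <= j < k) f (w ^+ j) = - (k%:R * (k%:R ^+ 2 - 1) / 6).
  by apply/eqP; rewrite -addr_eq0 addrC sum_all.
by field.
Qed.

End RootSums.

(** * Limits of the finite identities *)


Section Limits.
Context {R : realType}.
Implicit Types (b : nat -> CC R) (q x w y : CC R).

Lemma seq_cvg_cst (l : CC R) : (fun=> l) n @[n --> \oo] --> l.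
Proof. exact: cvg_cst. Qed.

Lemma seq_cvgD (a b : nat -> CC R) (la lb : CC R) : a n @[n --> \oo] --> la ->
  b n @[n --> \oo] --> lb -> a n + b n @[n --> \oo] --> la + lb.
Proof. by move=> ha hb; exact: (cvgD ha hb). Qed.

Lemma seq_cvgB (a b : nat -> CC R) (la lb : CC R) : a n @[n --> \oo] --> la ->
  b n @[n --> \oo] --> lb -> a n - b n @[n --> \oo] --> la - lb.
Proof. by move=> ha hb; exact: (cvgB ha hb). Qed.

Lemma seq_cvgM (a b : nat -> CC R) (la lb : CC R) : a n @[n --> \oo] --> la ->
  b n @[n --> \oo] --> lb -> a n * b n @[n --> \oo] --> la * lb.
Proof. by move=> ha hb; exact: (cvgM ha hb). Qed.

Lemma seq_cvg_unique (a : nat -> CC R) (l l' : CC R) : a n @[n --> \oo] --> l ->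
  a n @[n --> \oo] --> l' -> l = l'.
Proof.
move=> h h'; rewrite -(cvg_lim (@norm_hausdorff _ _) h).
exact: (cvg_lim (@norm_hausdorff _ _) h').
Qed.

Lemma seq_cvg_sum (k : nat) (a : nat -> nat -> CC R) (l : nat -> CC R) :
  (forall j, (0 < j < k)%N -> a j n @[n --> \oo] --> l j) ->
  \sum_(1 <= j < k) a j n @[n --> \oo] --> \sum_(1 <= j < k) l j.
Proof.
elim: k => [|[|k] IH] h.
- by rewrite big_geq//; under eq_fun do rewrite big_geq//; exact: cvg_cst.
- by rewrite big_geq//; under eq_fun do rewrite big_geq//; exact: cvg_cst.
- rewrite big_nat_recr//=; under eq_fun do rewrite big_nat_recr//=.
  apply: seq_cvgD; last by apply: h; rewrite /= ltnSn.
  by apply: IH => j /andP[j0 jk]; apply: h; rewrite j0 ltnW.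
Qed.

Lemma geo_sum_uniform b (c : nat -> nat -> CC R) : geo b ->
  (forall N n, (0 < n <= N)%N -> cmod (c N n) <= cmod (b N)) ->
  geo (fun N => \sum_(1 <= n < N.+1) c N n).
Proof.
move=> /geo_natM gb h; apply: (@geo_le _ _ _ 1 _ gb) => N.
rewrite mul1r cmodM cmod_nat (le_trans (cmod_sum _ _ _))//.
have -> : N%:R * cmod (b N) = \sum_(1 <= n < N.+1) cmod (b N).
  by rewrite sumr_const_nat subSS subn0 mulr_natl.
rewrite !big_nat.
by apply: ler_sum => n; rewrite ltnS; exact: h.
Qed.

Lemma cvg_geo_diff b (c : nat -> CC R) (l : CC R) :
  geo (fun N => b N - c N) -> c N @[N --> \oo] --> l -> b N @[N --> \oo] --> l.
Proof.
move=> /geo_cvg0 bc cl; have := seq_cvgD bc cl; rewrite add0r.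
by apply: cvg_trans; apply: near_eq_cvg; apply: nearW => N /=; rewrite subrK.
Qed.

Lemma cmod_lt1_neq (z : CC R) : cmod z < 1 -> 1 - z != 0.
Proof.
by apply: contraTneq => /subr0_eq <-; rewrite cmod1 ltxx.
Qed.

Lemma cmodX_lt1 q n : cmod q < 1 -> cmod (q ^+ n.+1) < 1.
Proof. by move=> q1; rewrite cmodX exprn_ilt1 ?cmod_ge0. Qed.

Lemma one_subX_neq0 q n : cmod q < 1 -> 1 - q ^+ n.+1 != 0.
Proof. by move=> q1; apply: cmod_lt1_neq; exact: cmodX_lt1. Qed.

Lemma geo_lambert q x : cmod q < 1 -> (forall n, 1 - q ^+ n * x != 0) ->
  geo (lambert q x).
Proof.
move=> q1 nz; have g : geo (fun n => - (q ^+ n * x)).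
  apply: (@geo_le _ _ _ (cmod x) _ (geoX q1)) => n.
  by rewrite cmodN cmodM mulrC.
have [B B0 hB] := geo_inv_bounded g nz.
apply: (@geo_le _ _ _ B _ g) => n.
by rewrite /lambert cmodN [leLHS]cmodM mulrC ler_wpM2r ?cmod_ge0.
Qed.

(* At x = 1 the term of index 0 is 0, by division by zero. *)
Lemma geo_lambert1 q : cmod q < 1 -> geo (lambert q 1).
Proof.
move=> q1; have g : geo (fun n => - q ^+ n.+1).
  apply: (@geo_le _ _ _ (cmod q) _ (geoX q1)) => n.
  by rewrite cmodN exprS cmodM.
have [B B0 hB] := geo_inv_bounded g (fun n => one_subX_neq0 n q1).
apply: (@geo_le _ _ _ B _ (geoX q1)) => -[|n].
  by rewrite /lambert expr0 mulr1 subrr invr0 mulr0 cmod0 mulr_ge0 ?cmod_ge0.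
by rewrite /lambert mulr1 [leLHS]cmodM mulrC ler_wpM2r ?cmod_ge0.
Qed.

(** An index d is in the window of m exactly when m > N - d, which happens for d values of m. *)
Lemma sum_window (e : nat -> CC R) N :
  \sum_(1 <= m < N.+1) \sum_((N - m).+1 <= d < N.+1) e d
  = \sum_(1 <= d < N.+1) d%:R * e d.
Proof.
elim: N => [|N IH]; first by rewrite !big_geq.
rewrite [RHS]big_nat_recr//= -IH.
transitivity (\sum_(1 <= m < N.+2) (\sum_((N.+1 - m).+1 <= d < N.+1) e d + e N.+1)).
  by apply: eq_big_nat => m mN; rewrite big_nat_recr//=; lia.
rewrite big_split/= sumr_const_nat subSS subn0 -[_ *+ N.+1]mulr_natl; congr (_ + _).
rewrite big_add1/= big_ltn//= subSS subn0 big_geq// add0r.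
by apply: eq_bigr => m _; rewrite subSS.
Qed.

Section CotangentSquareLimit.
Variables (q x : CC R).
Hypotheses (q1 : cmod q < 1) (x0 : x != 0)
  (ux : forall m, 1 - q ^+ m * x != 0) (vx : forall m, 1 - q ^+ m / x != 0).
Let u := lambert q x.
Let v := lambert q x^-1.
Let e := lambert q 1.

(** The part with [u m + v m] is a convolution, since the window at m has size about s^(N - m). In
    the part with 1, the indices d <= N are counted by [sum_window], and those beyond N decay. *)
Let window_tail : geo (fun N =>
  \sum_(1 <= m < N.+1) (1 + u m + v m) * \sum_((N - m).+1 <= d < (N + m).+1) e d
  - \sum_(1 <= d < N.+1) d%:R * e d).
Proof.
have [K [s [K0 s01 he]]] := geo_lambert1 q1.
have /andP[s0 s1] := s01; have d0 : 0 < 1 - s by rewrite subr_gt0.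
have window_le M N : cmod (\sum_(M <= d < N) e d) <= K / (1 - s) * s ^+ M.
  apply: (le_trans (cmod_sum _ _ _)).
  apply: (@le_trans _ _ (K * \sum_(M <= d < N) s ^+ d)).
    by rewrite mulr_sumr ler_sum.
  by rewrite mulrAC -mulrA ler_wpM2l// geometric_sum_le.
have C0 : 0 <= K / (1 - s) by rewrite divr_ge0 ?(ltW d0).
have g1 : geo (fun N => \sum_(0 <= m < N.+1)
    (u m + v m) * \sum_((N - m).+1 <= d < (N + m).+1) e d).
  apply: (geo_convolution _ C0 s01) => [|N n nN].
    by apply: geoD; exact: geo_lambert.
  apply: (le_trans (window_le _ _)); rewrite ler_wpM2l//.
  by rewrite ler_wiXn2l ?(ltW s0, ltW s1).
have g2 : geo (fun N => \sum_(1 <= m < N.+1) \sum_(N.+1 <= d < (N + m).+1) e d).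
  apply: (@geo_sum_uniform (fun N => toCC (K / (1 - s) * s ^+ N))).
    exists (K / (1 - s)), s; split => // n.
    by rewrite cmod_toCC ger0_norm// mulr_ge0// exprn_ge0 ?(ltW s0).
  move=> N n nN; rewrite cmod_toCC ger0_norm; last first.
    by rewrite mulr_ge0// exprn_ge0 ?(ltW s0).
  apply: (le_trans (window_le _ _)); rewrite ler_wpM2l//.
  by rewrite ler_wiXn2l ?(ltW s0, ltW s1).
rewrite (_ : (fun N => _) = (fun N => \sum_(0 <= m < N.+1)
    (u m + v m) * \sum_((N - m).+1 <= d < (N + m).+1) e d
  + \sum_(1 <= m < N.+1) \sum_(N.+1 <= d < (N + m).+1) e d)); first exact: geoD.
apply/funext => N; rewrite -sum_window.
rewrite [X in _ = X + _]big_ltn// subn0 addn0 (@big_geq _ _ _ N.+1 N.+1)// mulr0 add0r.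
rewrite -sumrB -big_split/=; apply: eq_big_nat => m mN.
have -> : \sum_((N - m).+1 <= d < (N + m).+1) e d
    = \sum_((N - m).+1 <= d < N.+1) e d + \sum_(N.+1 <= d < (N + m).+1) e d.
  by rewrite -big_cat_nat//; lia.
by ring.
Qed.

Lemma cotangent_square (L P : CC R) (A := 1 / 2 + x / (1 - x)) :
  \sum_(1 <= m < N.+1) (u m - v m) @[N --> \oo] --> L ->
  \sum_(1 <= d < N.+1) d%:R * e d @[N --> \oo] --> P ->
  (\sum_(1 <= m < N.+1) (u m + u m ^+ 2 + (v m + v m ^+ 2))
     - 2 * \sum_(1 <= m < N.+1) m%:R * (u m + v m)) @[N --> \oo]
    --> (A + L) ^+ 2 - A ^+ 2 + 2 * P.
Proof.
move=> cL cP; have cE := cvg_geo_diff window_tail cP.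
have hA := seq_cvgD (@seq_cvg_cst A) cL.
have h := seq_cvgD (seq_cvgB (seq_cvgM hA hA) (@seq_cvg_cst (A * A)))
  (seq_cvgM (@seq_cvg_cst 2) cE).
rewrite !expr2; apply: cvg_trans h.
apply: near_eq_cvg; apply: nearW => N /=; rewrite -!expr2.
rewrite /A finite_cotangent_square//; last by move=> m; exact: one_subX_neq0.
by ring.
Qed.

End CotangentSquareLimit.

(* Both sides are the double sum of m y^(nm) over 1 <= n, m <= N, up to terms
   of geometric decay. *)
Lemma lambert_divisor_sum y : cmod y < 1 ->
  geo (fun N => \sum_(1 <= n < N.+1) (lambert y 1 n + lambert y 1 n ^+ 2)
    - \sum_(1 <= m < N.+1) m%:R * lambert y 1 m).
Proof.
move=> y1; pose e := lambert y 1.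
have [B B0 hB] := geo_bounded (geo_lambert1 y1).
have eE n : (0 < n)%N -> e n = y ^+ n / (1 - y ^+ n) /\ 1 - y ^+ n != 0.
  case: n => // n _; rewrite /e /lambert mulr1; split => //.
  exact: one_subX_neq0.
(* With t = y^n, [e n + e n ^+ 2] is t/(1 - t)^2, the sum of all m t^m. *)
have rowE N n : (0 < n)%N -> e n + e n ^+ 2
    = \sum_(1 <= m < N.+1) m%:R * y ^+ (n * m)
      + (y ^+ n) ^+ N * (N.+1%:R * e n + e n ^+ 2).
  move=> /eE[-> h]; under eq_bigr do rewrite exprM.
  move: (y ^+ n) h => t h; elim: N => [|N IH].
    by rewrite big_geq// expr0; field.
  rewrite big_nat_recr//= IH -[N.+2%:R]natr1 -[N.+1%:R]natr1 [t ^+ N.+1]exprS.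
  by move: (t ^+ N) (N%:R : CC R) => s n'; field.
have colE N m : (0 < m)%N -> m%:R * e m
    = \sum_(1 <= n < N.+1) m%:R * y ^+ (n * m) + (y ^+ m) ^+ N * (m%:R * e m).
  move=> /eE[-> h]; under eq_bigr do rewrite mulnC exprM.
  rewrite -mulr_sumr.
  move: (y ^+ m) h => t h; elim: N => [|N IH].
    by rewrite big_geq// expr0; ring.
  rewrite big_nat_recr//= mulrDr {1}IH [t ^+ N.+1]exprS.
  by move: (t ^+ N) (m%:R : CC R) => s n'; field.
pose M : CC R := toCC (2 * B + B ^+ 2).
have gb : geo (fun N => (N%:R * y ^+ N + y ^+ N) * M).
  apply: geoM_bounded; last by exists (cmod M) => //; exact: cmod_ge0.
  by apply: geoD; [apply: geo_natM|]; exact: geoX.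
have bE N : cmod ((N%:R * y ^+ N + y ^+ N) * M) = N.+1%:R * cmod y ^+ N * (2 * B + B ^+ 2).
  rewrite -{2}[y ^+ N]mul1r -mulrDl natr1 !cmodM cmod_nat cmodX cmod_toCC.
  by rewrite ger0_norm// addr_ge0 ?mulr_ge0 ?sqr_ge0.
have yle N n : (0 < n)%N -> cmod ((y ^+ n) ^+ N) <= cmod y ^+ N.
  move=> n0; rewrite -exprM !cmodX ler_wiXn2l ?cmod_ge0 ?(ltW y1)//.
  by rewrite leq_pmull.
have N1 N : 1 <= N.+1%:R :> R by rewrite ler1n.
rewrite (_ : (fun N => _) = (fun N =>
    \sum_(1 <= n < N.+1) ((y ^+ n) ^+ N * (N.+1%:R * e n + e n ^+ 2)
      - (y ^+ n) ^+ N * (n%:R * e n)))).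
  apply: (geo_sum_uniform gb) => N n /andP[n0 nN]; rewrite bE.
  rewrite -mulrBr cmodM -[leRHS]mulrA [leRHS]mulrCA; apply: ler_pM; rewrite ?cmod_ge0 ?yle//.
    have := hB n; rewrite -/(e n); move: (e n) => E EB; have E0 := cmod_ge0 E.
  apply: (le_trans (cmod_subD _ _)); rewrite !cmodM cmod_nat.
  apply: (le_trans (lerD (cmodD _ _) (lexx _))); rewrite cmodM cmodX cmod_nat.
  have nN' : n%:R <= N.+1%:R :> R by rewrite ler_nat ltnW.
  have h1 : N.+1%:R * cmod E <= N.+1%:R * B by rewrite ler_wpM2l.
  have h2 : n%:R * cmod E <= N.+1%:R * B by rewrite ler_pM.
  have h3 : cmod E ^+ 2 <= B ^+ 2 by rewrite lerXn2r ?nnegrE.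
  have h4 : B ^+ 2 <= N.+1%:R * B ^+ 2 by rewrite ler_peMl ?sqr_ge0.
  lra.
apply/funext => N; rewrite sumrB.
rewrite (eq_big_nat _ _ (F2 := fun n => \sum_(1 <= m < N.+1) m%:R * y ^+ (n * m)
      + (y ^+ n) ^+ N * (N.+1%:R * e n + e n ^+ 2))); last first.
  by move=> n /andP[n0 _]; rewrite -rowE.
rewrite [X in _ - X](eq_big_nat _ _ (F2 := fun m =>
  \sum_(1 <= n < N.+1) m%:R * y ^+ (n * m) + (y ^+ m) ^+ N * (m%:R * e m))); last first.
  by move=> n /andP[n0 _]; rewrite -colE.
by rewrite !big_split/= exchange_big/=; ring.
Qed.

(** In the triple product the negative half of the series runs over n + 1; padding with a zero term
    brings it into the form required by [geo_convolution]. *)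
Lemma geo_shift b : geo b -> geo (fun n => if n is m.+1 then b m else 0).
Proof.
move=> [K [s [K0 s01 h]]]; have /andP[s0 s1] := s01.
exists (K / s), s; split => //; first by rewrite divr_ge0 ?(ltW s0).
case=> [|n]; first by rewrite cmod0 expr0 mulr1 divr_ge0 ?(ltW s0).
by rewrite exprS mulrA mulfVK ?gt_eqF.
Qed.

Section TripleProduct.
Variables (q w : CC R).
Hypotheses (q0 : q != 0) (w0 : w != 0) (q1 : cmod q < 1)
  (qw : cmod (q * w) < 1) (qw' : cmod (q / w) < 1).

(** Linear growth of the exponent suffices for convergence in the annulus given by [qw] and
    [qw']. *)
Let qX_le n : cmod (q ^+ 'C(n.+1, 2)) <= cmod (q ^+ n).
Proof.
rewrite !cmodX ler_wiXn2l ?cmod_ge0 ?(ltW q1)//.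
by rewrite binS bin1 leq_addl.
Qed.

Lemma geo_theta_pos : geo (fun n => q ^+ 'C(n.+1, 2) * w ^+ n).
Proof.
apply: (@geo_le _ _ _ 1 _ (geoX qw)) => n.
by rewrite mul1r exprMn !cmodM ler_wpM2r ?cmod_ge0.
Qed.

Lemma geo_theta_neg : geo (fun n => q ^+ 'C(n.+1, 2) / w ^+ n.+1).
Proof.
apply: (@geo_le _ _ _ (cmod w^-1) _ (geoX qw')) => n.
rewrite exprMn !cmodM exprS invfM cmodM exprVn.
by rewrite mulrCA ler_wpM2l ?cmod_ge0// ler_wpM2r ?cmod_ge0.
Qed.

Lemma geo_qX : geo (fun n => - q ^+ n.+1).
Proof.
by apply: (@geo_le _ _ _ (cmod q) _ (geoX q1)) => n; rewrite cmodN exprS cmodM.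
Qed.

(** The q-binomial coefficients tend to [E^-1], with an error of order s^(N - n). For n near N this
    is not small, but there the theta terms are, so that the total error is a decaying
    convolution. *)
Lemma triple_product (E P M T1 T2 : CC R) :
  \prod_(0 <= j < N) (1 - q ^+ j.+1) @[N --> \oo] --> E ->
  \prod_(0 <= j < N) (1 + q ^+ j.+1 * w) @[N --> \oo] --> P ->
  \prod_(0 <= j < N) (1 + q ^+ j / w) @[N --> \oo] --> M ->
  \sum_(0 <= n < N) q ^+ 'C(n.+1, 2) * w ^+ n @[N --> \oo] --> T1 ->
  \sum_(0 <= n < N) q ^+ 'C(n.+1, 2) / w ^+ n.+1 @[N --> \oo] --> T2 ->
  T1 + T2 = E * (P * M).
Proof.
move=> cE cP cM cT1 cT2.
have nz n : 1 - q ^+ n.+1 != 0 by exact: one_subX_neq0.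
have E0 : E != 0 := geo_prod_neq0 geo_qX nz cE.
have gE : geo (fun N => qfact q N - E).
  have [E' gE'] := geo_prod geo_qX.
  have cE' := geo_cvg gE'.
  by rewrite (seq_cvg_unique cE cE').
have [B B0 hB] : bounded_seq (fun N => (qfact q N)^-1).
  exact: (cvg_bounded_seq (cvgV E0 cE)).
have [K [s [K0 s01 hK]]] := gE; have /andP[s0 s1] := s01.
pose d N n := qfact q (N + N) / (qfact q (N + n) * qfact q (N - n)) - E^-1.
(* [d N n] is expanded in the deviations of its three [qfact] from [E]: three linear terms and one
   product. *)
pose C := cmod E^-1 * (B * B) * (cmod E * (3 * K) + K * K).
have C0 : 0 <= C.
  by rewrite /C !mulr_ge0 ?addr_ge0 ?mulr_ge0 ?cmod_ge0.
have hd N n : (n <= N)%N -> cmod (d N n) <= C * s ^+ (N - n).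
  move=> nN.
  have sle m : (N - n <= m)%N -> K * s ^+ m <= K * s ^+ (N - n).
    by move=> h; rewrite ler_wpM2l// ler_wiXn2l ?(ltW s0, ltW s1).
  have := le_trans (hK (N + N)%N) (sle _ _); have := le_trans (hK (N + n)%N) (sle _ _).
  have := hK (N - n)%N; have := hB (N + n)%N; have := hB (N - n)%N.
  have := qfact_neq0 nz (N + n); have := qfact_neq0 nz (N - n).
  have := ltW s1; rewrite /d /C.
  have S1 : s ^+ (N - n) <= 1 by rewrite exprn_ile1 ?(ltW s0) ?(ltW s1).
  have S0 : 0 <= s ^+ (N - n) by rewrite exprn_ge0 ?(ltW s0).
  move: (qfact q (N + N)) (qfact q (N + n)) (qfact q (N - n)) (s ^+ (N - n)) S1 S0.
  move=> a b c S S1 S0 _ c0 b0 cB bB cS bS aS.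
  have {}aS := aS (leq_trans (leq_subr _ _) (leq_addr _ _)).
  have {}bS := bS (leq_trans (leq_subr _ _) (leq_addr _ _)).
  have -> : a / (b * c) - E^-1
      = E^-1 * (b^-1 * c^-1) * (E * ((a - E) - (b - E) - (c - E)) - (b - E) * (c - E)).
    by field; rewrite E0 b0 c0.
  rewrite cmodM -[leRHS]mulrA; apply: ler_pM; rewrite ?cmod_ge0//.
    by rewrite !cmodM ler_wpM2l ?cmod_ge0// ler_pM ?cmod_ge0.
  apply: (le_trans (cmod_subD _ _)); rewrite [leRHS]mulrDl lerD// cmodM.
    rewrite -[leRHS]mulrA ler_wpM2l ?cmod_ge0//.
    apply: (le_trans (cmod_subD _ _)); apply: (le_trans (lerD (cmod_subD _ _) (lexx _))).
    lra.
  have KS : K * S <= K by rewrite ler_piMr.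
  rewrite -[leRHS]mulrA; apply: ler_pM; rewrite ?cmod_ge0//.
  exact: le_trans KS.
have cS : (\sum_(0 <= n < N.+1) q ^+ 'C(n.+1, 2) * w ^+ n
    + \sum_(0 <= n < N) q ^+ 'C(n.+1, 2) / w ^+ n.+1) @[N --> \oo] --> T1 + T2.
  apply: seq_cvgD cT2.
  by move: cT1; rewrite -(cvg_shiftS (fun N => \sum_(0 <= n < N) _)).
have gD := geoD (geo_convolution geo_theta_pos C0 s01 hd)
  (geo_convolution (geo_shift geo_theta_neg) C0 s01 hd).
have cPM : (\prod_(0 <= j < N) (1 + q ^+ j.+1 * w) * \prod_(0 <= j < N) (1 + q ^+ j / w))
   @[N --> \oo] --> E^-1 * (T1 + T2).
  apply: (cvg_geo_diff _ (seq_cvgM (@seq_cvg_cst E^-1) cS)).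
  move: gD; congr geo; apply/funext => N.
  rewrite finite_triple_product// [X in _ + X = _]big_ltn// mul0r add0r.
  rewrite [X in _ + X = _]big_add1/=.
  rewrite mulrDr !mulr_sumr opprD addrACA -!sumrB; congr (_ + _).
    by apply: eq_bigr => n _; rewrite /d; ring.
  by apply: eq_bigr => n _; rewrite /d; ring.
rewrite (seq_cvg_unique (seq_cvgM cP cM) cPM).
by rewrite mulrA mulfV// mul1r.
Qed.

End TripleProduct.
End Limits.

(** * The eta function *)


Section LogDerivatives.
Context {R : realType}.
Implicit Types (F G : CC R -> CC R) (z t A B a : CC R).

(** Unlike an equation for [dlog], this carries the non-vanishing and the differentiability that the
    rules for products, inverses and powers use. *)
Definition has_dlog F z A := F z != 0 /\ is_derive z 1 F (F z * A).

Lemma dlog_eq F z A : has_dlog F z A -> dlog F z = A.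
Proof.
move=> [F0 dF]; rewrite /dlog derive1E derive_val.
by rewrite mulrC mulKf.
Qed.

Lemma has_dlogM F G z A B : has_dlog F z A -> has_dlog G z B ->
  has_dlog (fun t => F t * G t) z (A + B).
Proof.
move=> [F0 dF] [G0 dG]; split; first by rewrite mulf_neq0.
apply: (is_derive_eq (is_deriveM dF dG)).
by rewrite /GRing.scale/=; ring.
Qed.

Lemma has_dlogV F z A : has_dlog F z A -> has_dlog (fun t => (F t)^-1) z (- A).
Proof.
move=> [F0 dF]; split; first by rewrite invr_eq0.
case: (dF) => dF1 dF2; split; first exact: derivableV.
by rewrite deriveV// dF2 /GRing.scale/=; field.
Qed.

Lemma has_dlog_cst a z : a != 0 -> has_dlog (fun=> a) z 0.
Proof. by move=> a0; split; rewrite ?mulr0//; exact: is_derive_cst. Qed.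

Lemma has_dlogX F z A n : has_dlog F z A ->
  has_dlog (fun t => F t ^+ n) z (n%:R * A).
Proof.
move=> hF; elim: n => [|n IH].
  by rewrite mul0r; exact: has_dlog_cst (oner_neq0 _).
have := has_dlogM hF IH.
have -> : A + n%:R * A = n.+1%:R * A by rewrite -[n.+1%:R]natr1; ring.
by under [X in has_dlog X]eq_fun do rewrite -exprS.
Qed.

Lemma has_dlog_cexp a z : has_dlog (fun t => cexp (a * t)) z a.
Proof.
split; first exact: cexp_neq0.
apply: (@is_derive_second_order _ _ _ _ 1
  (cmod (cexp (a * z)) * (8 * expR (2 * (1 * cmod a))))) => // h h1.
have -> : cexp (a * (h + z)) - cexp (a * z) - h * (cexp (a * z) * a)
  = cexp (a * z) * (cexp (a * h) - 1 - a * h) by rewrite mulrDr cexpD; ring.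
rewrite cmodM -mulrA ler_wpM2l ?cmod_ge0//.
have := @cexp_sub1D_scaled _ 1 a h ltr01 h1; rewrite divr1.
by rewrite mulrAC.
Qed.

(** No convergence is involved: both sequences have the same set of limits, from which [get]
    chooses. *)
Lemma limn_shiftS (u : nat -> CC R) : limn (fun n => u n.+1) = limn u.
Proof.
rewrite /lim; congr get; apply/funext => l.
exact: (cvg_shiftS u).
Qed.

Definition twopii : CC R := 2 * cpi R * ci R.

Lemma twopii_neq0 : twopii != 0.
Proof.
have pi0 : cpi R != 0 by rewrite -cmod_gt0 cmod_toCC normr_gt0 gt_eqF// pi_gt0.
by rewrite !mulf_neq0// -cmod_gt0 cmod_ci.
Qed.

Lemma cmod_twopii : cmod twopii = 2 * pi.
Proof.
by rewrite !cmodM cmod_ci mulr1 cmod_nat cmod_toCC ger0_norm ?pi_ge0.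
Qed.

Lemma Re_twopii z : complex.Re (twopii * z) = - (2 * pi * complex.Im z).
Proof. by rewrite !(ccReM, ccImM) /=; ring. Qed.

Section Nome.
Variables (tau : CC R).
Hypothesis tau0 : 0 < complex.Im tau.

Definition nome := cexp (twopii * tau).

Lemma cmod_nome : cmod nome = expR (- (2 * pi * complex.Im tau)).
Proof. by rewrite cmod_cexp Re_twopii. Qed.

Lemma nome_lt1 : cmod nome < 1.
Proof.
by rewrite cmod_nome -expR0 ltr_expR oppr_lt0 !mulr_gt0 ?pi_gt0.
Qed.

Lemma qpow_nome n : qpow tau n%:R = nome ^+ n.
Proof.
by rewrite /qpow -cexpMn; congr cexp; rewrite /twopii; ring.
Qed.

Lemma eta_has_dlog m (P : CC R) : (0 < m)%N ->
  \sum_(1 <= d < N.+1) d%:R * lambert (nome ^+ m) 1 d @[N --> \oo] --> P ->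
  has_dlog (fun t => eta (m%:R * t)) tau (twopii * (m%:R / 24 - m%:R * P)).
Proof.
move=> m0 cP.
pose s n := twopii * (n.+1 * m)%:R.
have sE n : cexp (s n * tau) = (nome ^+ m) ^+ n.+1.
  by rewrite -exprM mulnC -cexpMn; congr cexp; rewrite /s; ring.
have sN n : cmod (s n) = 2 * pi * (n.+1 * m)%:R.
  by rewrite cmodM cmod_twopii cmod_nat.
have sD n : s n = twopii * (n.+1 * m)%:R by [].
(* With this radius the weight is |q|^(-m (n + 1)/2), which cancels half of the decay |q|^(m (n +
   1)); powers of [sigma] = |q|^(1/2) remain. *)
clearbody s; pose r := complex.Im tau / 4.
have r0 : 0 < r by rewrite divr_gt0.
pose sigma := expR (- (pi * complex.Im tau)).
have sigma1 : sigma < 1.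
  by rewrite /sigma -expR0 ltr_expR oppr_lt0 !mulr_gt0 ?pi_gt0.
have g : geo (fun n => - 1 * cexp (s n * tau) * toCC (expR (2 * (r * cmod (s n))))).
  have gs : geo (fun n => toCC sigma ^+ n).
    by apply: geoX; rewrite cmod_toCC ger0_norm ?expR_ge0.
  apply: (@geo_le _ _ _ 1 _ gs) => n.
  rewrite mul1r !cmodM cmodN cmod1 mul1r cmod_toCC cmodX cmod_toCC.
  rewrite !(ger0_norm (expR_ge0 _)) sE -exprM cmodX cmod_nome.
  rewrite sN /sigma -!expRM_natl -expRD ler_expR.
  have h1 : (n%:R : R) <= (m * n.+1)%:R.
    by rewrite ler_nat (leq_trans (leqnSn n))// leq_pmull.
  have := mulr_gt0 (pi_gt0 R) tau0.
  rewrite [(n.+1 * m)%N]mulnC /r; move: h1 (pi : R) (complex.Im tau).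
  move: (m * n.+1)%:R (n%:R : R) => M N NM p y py.
  have : N * (p * y) <= M * (p * y) by rewrite ler_wpM2r// ltW.
  lra.
have qm1 : cmod (nome ^+ m) < 1 by rewrite -(prednK m0) cmodX_lt1// nome_lt1.
have nz n : 1 + - 1 * cexp (s n * tau) != 0.
  by rewrite mulN1r sE; exact: one_subX_neq0.
have [A [F0 cA dF]] := is_derive_prod_exp r0 g nz.
have AE : A = twopii * m%:R * - P.
  apply: (seq_cvg_unique cA).
  have h := seq_cvgM (@seq_cvg_cst R (- (twopii * m%:R))) cP.
  rewrite mulrN -mulNr; apply: cvg_trans h; apply: near_eq_cvg; apply: nearW => N /=.
  rewrite big_add1/= mulr_sumr; apply: eq_bigr => n _.
  by rewrite sE sD natrM /lambert !mulN1r mulr1; ring.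
have := has_dlogM (has_dlog_cexp (twopii * (m%:R / 24)) tau) (conj F0 dF).
have -> : twopii * (m%:R / 24) + A = twopii * (m%:R / 24 - m%:R * P).
  by rewrite AE; ring.
have etaE t : eta (m%:R * t) = cexp (twopii * (m%:R / 24) * t)
    * limn (fun N => \prod_(0 <= n < N) (1 + - 1 * cexp (s n * t))).
  have prodE N : \prod_(1 <= n < N.+1) (1 - qpow (m%:R * t) n%:R)
      = \prod_(0 <= n < N) (1 + - 1 * cexp (s n * t)).
    rewrite big_add1/=; apply: eq_bigr => n _; rewrite mulN1r /qpow sD natrM.
    rewrite -/twopii (_ : _ * (m%:R * t) = twopii * (n.+1%:R * m%:R) * t)//.
    by ring.
  rewrite /eta -limn_shiftS (funext prodE) /qpow -/twopii.
  by rewrite (_ : _ * (m%:R * t) = twopii * (m%:R / 24) * t)//; ring.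
by rewrite (funext etaE).
Qed.

End Nome.
End LogDerivatives.

(** * The theta function *)


Section ThetaLogDerivative.
Context {R : realType}.
Variables (tau : CC R).
Hypothesis tau0 : 0 < complex.Im tau.
Let q := nome tau.
Let q1 : cmod q < 1 := nome_lt1 tau0.
Let q0 : q != 0 := cexp_neq0 _.

Definition twoci : CC R := 2 * ci R.

Let cmod_twoci : cmod twoci = 2.
Proof. by rewrite cmodM cmod_ci mulr1 cmod_nat. Qed.

(** Since (2 n + 1)^2/8 = 1/8 + n (n + 1)/2. Only the square of [a] matters, so the indices n and -
    (n + 1) are treated alike. *)
Lemma qpow_square n (a : CC R) : a ^+ 2 = (2 * n%:R + 1) ^+ 2 ->
  qpow tau (a ^+ 2 / 8) = qpow tau (1 / 8) * q ^+ 'C(n.+1, 2).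
Proof.
move=> ->; rewrite -(qpow_nome tau) /qpow -cexpD; congr cexp.
have e : 'C(n.+1, 2)%:R * 2 + (n%:R + 1) = (n%:R + 1) * (n%:R + 1) :> CC R.
  by rewrite natr1 -!natrM -natrD bin2_double.
have -> : 'C(n.+1, 2)%:R = (n%:R * n%:R + n%:R) / 2 :> CC R.
  by apply: (canRL (mulfK _)) => //; apply: (addIr (n%:R + 1)); rewrite e; ring.
by field.
Qed.

Lemma theta2_product (z E P M : CC R) (w := cexp (twoci * z)) :
  cmod (q * w) < 1 -> cmod (q / w) < 1 ->
  \prod_(0 <= j < N) (1 - q ^+ j.+1) @[N --> \oo] --> E ->
  \prod_(0 <= j < N) (1 + q ^+ j.+1 * w) @[N --> \oo] --> P ->
  \prod_(0 <= j < N) (1 + q ^+ j / w) @[N --> \oo] --> M ->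
  theta2 z tau = qpow tau (1 / 8) * cexp (ci R * z) * (E * (P * M)).
Proof.
move=> qw qw' cE cP cM; have w0 : w != 0 := cexp_neq0 _.
have [T1 /geo_cvg cT1] := geo_series (geo_theta_pos q1 qw).
have [T2 /geo_cvg cT2] := geo_series (geo_theta_neg q1 qw').
rewrite -(triple_product q0 w0 q1 qw qw' cE cP cM cT1 cT2).
set C := qpow tau (1 / 8) * cexp (ci R * z).
pose u (n : int) : CC R :=
  qpow tau ((2 * n%:~R + 1) ^+ 2 / 8) * cexp (ci R * (2 * n%:~R + 1) * z).
have pos n : u (Posz n) = C * (q ^+ 'C(n.+1, 2) * w ^+ n).
  rewrite /u -pmulrn (qpow_square (n := n))// /C.
  rewrite (_ : ci R * (2 * n%:R + 1) * z = ci R * z + twoci * z * n%:R); last first.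
    by rewrite /twoci; ring.
  by rewrite cexpD cexpMn -/w; ring.
have neg n : u (Negz n) = C * (q ^+ 'C(n.+1, 2) / w ^+ n.+1).
  have nE : (Negz n)%:~R = - (n%:R + 1) :> CC R.
    by rewrite NegzE mulrNz -pmulrn natr1.
  rewrite /u nE (qpow_square (n := n)); last by ring.
  rewrite (_ : ci R * _ * z = ci R * z + - (twoci * z * n.+1%:R)); last first.
    by rewrite /twoci -[n.+1%:R]natr1; ring.
  by rewrite cexpD cexpN cexpMn -/w /C; ring.
rewrite /theta2 /sumZ mulrDr; congr (_ + _).
  apply: (@cvg_lim _ (@norm_hausdorff _ _)).
  have h := seq_cvgM (@seq_cvg_cst R C) cT1; apply: cvg_trans h.
  apply: near_eq_cvg; apply: nearW => N /=; rewrite mulr_sumr.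
  by apply: eq_bigr => n _; rewrite -pos.
apply: (@cvg_lim _ (@norm_hausdorff _ _)).
have h := seq_cvgM (@seq_cvg_cst R C) cT2; apply: cvg_trans h.
apply: near_eq_cvg; apply: nearW => N /=; rewrite mulr_sumr.
by apply: eq_bigr => n _; rewrite -neg.
Qed.

Section AtPoint.
Variables (z0 : CC R).
Let w0 := cexp (twoci * z0).
Hypotheses (w0_unit : cmod w0 = 1) (w0_N1 : 1 + w0 != 0).
Let x := - w0.

(** For [cmod h <= r], the modulus of exp(2 i (h + z0)) stays between |q|^(1/2) and |q|^(-1/2),
    inside the annulus of the triple product. *)
Let r : R := pi * complex.Im tau / 2.
Let r0 : 0 < r. Proof. by rewrite divr_gt0// mulr_gt0 ?pi_gt0. Qed.

Let gp n : CC R := q ^+ n.+1.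
Let gm n : CC R := q ^+ n.
Let sp (n : nat) : CC R := twoci.
Let sm (n : nat) : CC R := - twoci.

Let geo_p : geo (fun n => gp n * cexp (sp n * z0) * toCC (expR (2 * (r * cmod (sp n))))).
Proof.
apply: (@geo_le _ _ _ (cmod q * expR (2 * (r * 2))) _ (geoX q1)) => n.
rewrite /sp -/w0 cmod_twoci !cmodM w0_unit cmod_toCC ger0_norm ?expR_ge0//.
by rewrite /gp exprS cmodM mulr1 mulrAC.
Qed.

Let geo_m : geo (fun n => gm n * cexp (sm n * z0) * toCC (expR (2 * (r * cmod (sm n))))).
Proof.
apply: (@geo_le _ _ _ (expR (2 * (r * 2))) _ (geoX q1)) => n.
rewrite /sm cmodN cmod_twoci mulNr cexpN -/w0 !cmodM cmodV w0_unit invr1.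
by rewrite cmod_toCC ger0_norm ?expR_ge0// mulr1 mulrC.
Qed.

Let nz_p n : 1 + gp n * cexp (sp n * z0) != 0.
Proof.
rewrite -[_ * _]opprK; apply: cmod_lt1_neq.
by rewrite cmodN cmodM w0_unit mulr1 cmodX_lt1.
Qed.

Let w00 : w0 != 0 := cexp_neq0 _.

Let nz_m n : 1 + gm n * cexp (sm n * z0) != 0.
Proof.
(* The factor 1 + 1/w at n = 0 is the only one that can vanish on the unit circle; [w0_N1] excludes
   this zero of theta2. *)
rewrite /sm mulNr cexpN -/w0; case: n => [|n].
  rewrite /gm expr0 mul1r (_ : 1 + w0^-1 = (1 + w0) / w0); last by field.
  by rewrite mulf_neq0 ?invr_eq0.
rewrite -[_ / _]opprK; apply: cmod_lt1_neq.
by rewrite cmodN cmodM cmodV w0_unit invr1 mulr1 cmodX_lt1.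
Qed.

Let annulus h : cmod h <= r -> cmod (q * cexp (twoci * (h + z0))) < 1
  /\ cmod (q / cexp (twoci * (h + z0))) < 1.
Proof.
move=> hr; have := le_trans (cmod_Im h) hr; rewrite ler_norml => /andP[h1 h2].
rewrite mulrDr cexpD -/w0 !cmodM cmodV !cmodM w0_unit mulr1 /q cmod_nome.
rewrite cmod_cexp -expRN -!expRD -expR0 !ltr_expR.
rewrite (_ : complex.Re (twoci * h) = - 2 * complex.Im h); last first.
  by rewrite /twoci !(ccReM, ccImM) /=; ring.
have := mulr_gt0 (pi_gt0 R) tau0; move: h1 h2; rewrite /r.
by move: (pi : R) (complex.Im tau) (complex.Im h) => p y t; rewrite expR0; split; lra.
Qed.

Lemma theta2_has_dlog : exists2 L : CC R,
  \sum_(1 <= m < N.+1) (lambert q x m - lambert q x^-1 m) @[N --> \oo] --> L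
  & has_dlog (fun z => theta2 z tau) z0
      (- 2 * ci R * (1 / 2 + x / (1 - x) + L)).
Proof.
have [E gE] := geo_prod (geo_qX q1); have cE := geo_cvg gE.
have E0 : E != 0 := geo_prod_neq0 (geo_qX q1) (fun n => one_subX_neq0 n q1) cE.
have [Ap [Fp0 cAp dFp]] := is_derive_prod_exp r0 geo_p nz_p.
have [Am [Fm0 cAm dFm]] := is_derive_prod_exp r0 geo_m nz_m.
have cvg_p (h : CC R) := prod_exp_factor_cvg geo_p (h := h).
have cvg_m (h : CC R) := prod_exp_factor_cvg geo_m (h := h).
set Fp := (fun t => limn _) in Fp0 dFp; set Fm := (fun t => limn _) in Fm0 dFm.
pose C := qpow tau (1 / 8).
have C0 : C != 0 by exact: cexp_neq0.
pose G z := C * cexp (ci R * z) * (E * (Fp z * Fm z)).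
have prod_dlog : has_dlog G z0 (0 + ci R + (0 + (Ap + Am))) := has_dlogM (has_dlogM (has_dlog_cst z0 C0) (has_dlog_cexp (ci R) z0))
  (has_dlogM (has_dlog_cst z0 E0)
    (has_dlogM (conj Fp0 dFp : has_dlog Fp z0 Ap) (conj Fm0 dFm : has_dlog Fm z0 Am))).
(* The product formula is available only in the annulus, hence near [z0]; that is enough for the
   derivative there. *)
have thetaE h : cmod h <= r -> theta2 (h + z0) tau = G (h + z0).
  move=> hr; have [a1 a2] := annulus hr.
  apply: theta2_product a1 a2 cE (cvg_p h hr) _.
  have := cvg_m h hr; rewrite -/(Fm _); apply: cvg_trans.
  apply: near_eq_cvg; apply: nearW => N /=; apply: eq_bigr => n _.
  by rewrite /sm mulNr cexpN.
clearbody G; have x1 : 1 - x != 0 by rewrite opprK.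
have x0 : x != 0 by rewrite oppr_eq0.
have c0 : ci R != 0 by rewrite -cmod_gt0 cmod_ci.
have tc0 : twoci != 0 by rewrite mulf_neq0.
(* The factor of index 0 in the second product has no partner in the first. Its contribution and the
   [ci R] from exp(i z) combine into [- 2 * ci R * (1 / 2 + x / (1 - x))]. *)
pose v0 := lambert q x^-1 0.
have v0E : v0 = (x - 1)^-1.
  have x1' : x - 1 != 0 by rewrite -opprB oppr_eq0.
  by rewrite /v0 /lambert expr0 mul1r; field; rewrite x0 x1'.
have uE n : sp n * (gp n * cexp (sp n * z0) / (1 + gp n * cexp (sp n * z0)))
    = - twoci * lambert q x n.+1.
  by rewrite /sp /gp -/w0 /lambert /x mulrN opprK; ring.
have vE n : sm n * (gm n * cexp (sm n * z0) / (1 + gm n * cexp (sm n * z0)))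
    = twoci * lambert q x^-1 n.
  by rewrite /sm /gm [- twoci * z0]mulNr cexpN -/w0 /lambert /x invrN mulrN opprK; ring.
have AE : - 2 * ci R * (1 / 2 + x / (1 - x) + (- twoci^-1 * (Ap + Am) + v0))
    = 0 + ci R + (0 + (Ap + Am)).
  have x1' : x - 1 != 0 by rewrite -opprB oppr_eq0.
  by rewrite v0E /twoci; field; rewrite x1 x1' c0.
exists (- twoci^-1 * (Ap + Am) + v0).
  have cAm' : \sum_(0 <= n < N.+1) sm n * (gm n * cexp (sm n * z0)
      / (1 + gm n * cexp (sm n * z0))) @[N --> \oo] --> Am.
    by rewrite (cvg_shiftS (fun N => \sum_(0 <= n < N) sm n * (gm n * cexp (sm n * z0)
      / (1 + gm n * cexp (sm n * z0))))).
  have h := seq_cvgD (seq_cvgM (@seq_cvg_cst R (- twoci^-1)) (seq_cvgD cAp cAm'))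
    (@seq_cvg_cst R v0).
  apply: cvg_trans h; apply: near_eq_cvg; apply: nearW => N /=.
  rewrite (eq_bigr _ (fun n _ => uE n)) (eq_bigr _ (fun n _ => vE n)).
  rewrite -!mulr_sumr (@big_ltn _ _ _ 0 N.+1)// -/v0 sumrB [X in _ = X - _]big_add1/=.
  move: (\sum_(0 <= n < N) _) (\sum_(1 <= n < N.+1) _) => X Y.
  by field.
rewrite AE; have [G0 dG] := prod_dlog.
have r00 : cmod (0 : CC R) <= r by rewrite cmod0 ltW.
have thetaE0 := thetaE 0 r00; rewrite add0r in thetaE0.
split; first by rewrite thetaE0.
rewrite thetaE0.
apply: (near_eq_is_derive _ dG).
near=> z.
have : `|z0 - z| < toCC r by near: z; apply: nbhsx_ballx; rewrite ltcR.
rewrite -normrN opprB cmodE => /ltW; rewrite toCC_ler => zr.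
by have := thetaE _ zr; rewrite subrK => ->.
Unshelve. all: by end_near. Qed.

End AtPoint.
End ThetaLogDerivative.

(** * Sums over roots of unity *)


Section ParitySums.
Variable V : nmodType.

Lemma sum_parity (G : nat -> V) k :
  \sum_(0 <= l < k | l == k %[mod 2]) G l
  = \sum_(0 <= i < k./2) G (i.*2 + odd k)%N.
Proof.
have gen (b : bool) m : \sum_(0 <= l < b + m.*2 | l == b + m.*2 %[mod 2]) G l
    = \sum_(0 <= i < m) G (i.*2 + b)%N.
  elim: m => [|m IH].
    by rewrite addn0 big_mkcond; case: b; rewrite ?big_nat1 ?big_geq.
  rewrite doubleS !addnS big_mkcond/= !big_nat_recr//= -IH [in RHS]big_mkcond/=.
  have e1 : (b + m.*2 == (b + m.*2).+2 %[mod 2]) by rewrite !modn2/= negbK.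
  have e2 : ((b + m.*2).+1 == (b + m.*2).+2 %[mod 2]) = false.
    by rewrite !modn2 /=; case: (odd _).
  rewrite e1 e2 addr0 [(m.*2 + b)%N]addnC; congr (_ + _).
by rewrite -gen odd_double_half.
Qed.

Lemma sum_reflect (phi : nat -> V) k :
  \sum_(1 <= j < k) phi (k - j)%N = \sum_(1 <= j < k) phi j.
Proof.
rewrite [RHS]big_nat_rev; apply: eq_big_nat => j _.
by rewrite add1n subSS.
Qed.

(** For even k the index k/2 is its own mirror image and would be counted once only, so its term has
    to vanish. *)
Lemma sum_fold (phi : nat -> V) k :
  (forall j, (0 < j < k)%N -> phi (k - j)%N = phi j) ->
  (~~ odd k -> phi k./2 = 0) ->
  \sum_(1 <= j < k) phi j = (\sum_(1 <= j < (k./2).+1) phi j) *+ 2.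
Proof.
move=> sym half; case: k => [|[|k]] in sym half *; first by rewrite !big_geq// mul0rn.
  by rewrite !big_geq// mul0rn.
set K := k.+2 in sym half *; set m := K./2.
have KE : K = (odd K + m.*2)%N by rewrite odd_double_half.
have m0 : (0 < m)%N by rewrite /m /K /=.
have mK : (m.+1 <= K)%N by rewrite KE -addnn; lia.
rewrite (@big_cat_nat _ _ _ m.+1)//= mulr2n; congr (_ + _).
rewrite big_nat_rev/=.
rewrite (eq_big_nat _ _ (F2 := fun j => phi (j - m)%N)); last first.
  move=> j /andP[mj jK]; rewrite -sym; last by lia.
  by congr phi; lia.
have -> : \sum_(m.+1 <= j < K) phi (j - m)%N = \sum_(1 <= j < K - m) phi j.
  rewrite -add1n big_addn; apply: eq_bigr => j _; by rewrite addnK.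
have [oK|eK] := boolP (odd K).
  by congr bigop.body; congr (index_iota _ _); move: KE; rewrite oK; lia.
have -> : (K - m = m)%N by move: KE; rewrite (negbTE eK); lia.
by rewrite (@big_nat_recr _ _ _ m 1)//= (half eK : phi m = 0) addr0.
Qed.

End ParitySums.

(** * The primitive root exp(2 pi i/k) and the odd function rho *)

Section RootOfUnity.
Context {R : realType}.
Implicit Types z x y q : CC R.

Definition root_unity k : CC R := cexp (twopii / k%:R).

Lemma root_unityX k j : root_unity k ^+ j = cexp (twopii * toCC (j%:R / k%:R)).
Proof.
rewrite -cexpMn; congr cexp; rewrite -mulrA; congr (_ * _).
have kV : toCC k%:R^-1 = k%:R^-1 :> CC R.
  by have := fmorphV (real_complex R) k%:R; rewrite (rmorph_nat (real_complex R)).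
by rewrite toCCM toCCn kV mulrC.
Qed.

Lemma Im_twopii (a : R) : complex.Im (twopii * toCC a) = 2 * pi * a.
Proof. by rewrite !(ccReM, ccImM) /=; ring. Qed.

Lemma cexp_twopii (a : R) : cexp (twopii * toCC a) = cis (2 * pi * a).
Proof.
by rewrite cexp_cis Re_twopii Im_twopii /= mulr0 oppr0 expR0 mul1r.
Qed.

Lemma root_unity_prim k : (0 < k)%N -> k.-primitive_root (root_unity k).
Proof.
move=> k0; have kn0 : k%:R != 0 :> R by rewrite pnatr_eq0 -lt0n.
have wk : root_unity k ^+ k = 1.
  rewrite root_unityX cexp_twopii divff// mulr1 mulr_natl.
  by apply: complexP; rewrite /= ?cos2pi ?sin2pi.
have [m pm mk] := prim_order_exists k0 wk.
have m0 := prim_order_gt0 pm.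
have [km|mk'] := eqVneq k m; first by move: pm; rewrite -km.
have mltk : (m < k)%N by rewrite ltn_neqAle eq_sym mk' dvdn_leq.
have := root_unityX k m; rewrite (prim_expr_order pm) cexp_twopii.
move=> /(congr1 (@complex.Re R)) /=.
(* Half the argument of the power lies strictly between 0 and pi, so cos (2 a) = 1 - 2 sin^2 a
   differs from 1. *)
set a := pi * (m%:R / k%:R) : R.
have sa : 0 < sin a.
  apply: sin_gt0_pi; rewrite /a; apply/andP; split.
    by rewrite mulr_gt0 ?pi_gt0 ?divr_gt0 ?ltr0n.
  by rewrite gtr_pMr ?pi_gt0// ltr_pdivrMr ?ltr0n// mul1r ltr_nat.
rewrite (_ : 2 * pi * _ = a + a); last by rewrite /a; ring.
rewrite cosD => e; have := cos2Dsin2 a; rewrite !expr2 => e2.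
have : 0 < sin a * sin a by rewrite mulr_gt0.
lra.
Qed.

Lemma cmod_root_unityX k j : cmod (root_unity k ^+ j) = 1.
Proof.
by rewrite root_unityX cmod_cexp Re_twopii /= mulr0 oppr0 expR0.
Qed.

Lemma cexp_pi : cexp (ci R * cpi R) = -1.
Proof.
have re : complex.Re (ci R * cpi R) = 0 by rewrite ccReM /=; ring.
have im : complex.Im (ci R * cpi R) = pi by rewrite ccImM /=; ring.
rewrite cexp_cis re im expR0 mul1r.
by apply: complexP; rewrite /= ?cospi ?sinpi ?oppr0.
Qed.

Lemma geo_series_from1 (b : nat -> CC R) : geo b ->
  exists l : CC R, \sum_(1 <= n < N.+1) b n @[N --> \oo] --> l.
Proof.
move=> gb; have [l /geo_cvg cl] := geo_series gb; exists (l - b 0%N).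
have cl' : \sum_(0 <= n < N.+1) b n @[N --> \oo] --> l.
  by rewrite (cvg_shiftS (fun N => \sum_(0 <= n < N) b n)).
have h := seq_cvgB cl' (@seq_cvg_cst R (b 0%N)).
apply: cvg_trans h; apply: near_eq_cvg; apply: nearW => N /=.
by rewrite big_ltn// addrAC subrr add0r.
Qed.

(** For x = exp(i t), the part outside the limit is (i/2) cot(t/2), which is odd under x <-> 1/x. *)
Definition rho q x : CC R := 1 / 2 + x / (1 - x)
  + limn (fun N => \sum_(1 <= m < N.+1) (lambert q x m - lambert q x^-1 m)).

Section Rho.
Variables (q x : CC R).
Hypotheses (q1 : cmod q < 1) (x_unit : cmod x = 1) (x1 : 1 - x != 0).

Let x0 : x != 0. Proof. by rewrite -cmod_gt0 x_unit. Qed.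

Lemma one_sub_qXM_neq0 m : 1 - q ^+ m * x != 0.
Proof.
case: m => [|m]; first by rewrite expr0 mul1r.
by apply: cmod_lt1_neq; rewrite cmodM x_unit mulr1 cmodX_lt1.
Qed.

Lemma one_sub_qXV_neq0 m : 1 - q ^+ m / x != 0.
Proof.
case: m => [|m].
  rewrite expr0 (_ : 1 - 1 / x = - (1 - x) / x); last by field.
  by rewrite mulf_neq0 ?oppr_eq0 ?invr_eq0.
by apply: cmod_lt1_neq; rewrite cmodM cmodV x_unit invr1 mulr1 cmodX_lt1.
Qed.

Lemma rho_eq (L : CC R) :
  \sum_(1 <= m < N.+1) (lambert q x m - lambert q x^-1 m) @[N --> \oo] --> L ->
  rho q x = 1 / 2 + x / (1 - x) + L.
Proof. by move=> h; rewrite /rho (cvg_lim (@norm_hausdorff _ _) h). Qed.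

Lemma rho_cvg : \sum_(1 <= m < N.+1) (lambert q x m - lambert q x^-1 m)
  @[N --> \oo] --> rho q x - (1 / 2 + x / (1 - x)).
Proof.
have g : geo (fun m => lambert q x m - lambert q x^-1 m).
  apply: geoD; first exact: geo_lambert q1 one_sub_qXM_neq0.
  apply: (@geo_le _ _ _ 1 _ (geo_lambert q1 one_sub_qXV_neq0)) => n.
  by rewrite mul1r cmodN.
have [L cL] := geo_series_from1 g.
by rewrite (rho_eq cL) addrC addKr.
Qed.

Lemma cotangent_square_cvg (P : CC R) :
  \sum_(1 <= d < N.+1) d%:R * lambert q 1 d @[N --> \oo] --> P ->
  (\sum_(1 <= m < N.+1) (lambert q x m + lambert q x m ^+ 2
       + (lambert q x^-1 m + lambert q x^-1 m ^+ 2))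
     - 2 * \sum_(1 <= m < N.+1) m%:R * (lambert q x m + lambert q x^-1 m))
    @[N --> \oo] --> rho q x ^+ 2 - (1 / 2 + x / (1 - x)) ^+ 2 + 2 * P.
Proof.
move=> cP; have := cotangent_square q1 x0 one_sub_qXM_neq0 one_sub_qXV_neq0 rho_cvg cP.
by rewrite [_ + (rho q x - _)]addrC subrK.
Qed.

End Rho.

Lemma rho_inv q x : cmod q < 1 -> cmod x = 1 -> 1 - x != 0 ->
  rho q x^-1 = - rho q x.
Proof.
move=> q1 xu x1; have x0 : x != 0 by rewrite -cmod_gt0 xu.
have h := seq_cvgM (@seq_cvg_cst R (-1)) (rho_cvg q1 xu x1).
rewrite (@rho_eq q x^-1 (-1 * (rho q x - (1 / 2 + x / (1 - x))))).
  have x1' : x - 1 != 0 by rewrite -opprB oppr_eq0.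
  by move: (rho q x) => r; field; rewrite x1 x0 x1'.
apply: cvg_trans h; apply: near_eq_cvg; apply: nearW => N /=.
by rewrite invrK mulr_sumr; apply: eq_bigr => m _; ring.
Qed.

End RootOfUnity.


(** * Evaluation of the theta sums *)

Section Evaluation.
Context {R : realType}.
Variables (tau : CC R).
Hypothesis tau0 : 0 < complex.Im tau.
Let q := nome tau.
Let q1 : cmod q < 1 := nome_lt1 tau0.

Section RootSum.
Variables (k : nat).
Hypothesis k0 : (0 < k)%N.
Let w := @root_unity R k.
Let wk : k.-primitive_root w := root_unity_prim k0.

Let w_unit j : cmod (w ^+ j) = 1 := @cmod_root_unityX R k j.

Let w_neq1 j : (0 < j < k)%N -> 1 - w ^+ j != 0.
Proof.
move=> /andP[j0 jk].
by rewrite subr_eq0 eq_sym -(prim_order_dvd wk) gtnNdvd.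
Qed.

Let w_sub j : (j <= k)%N -> w ^+ (k - j) = (w ^+ j)^-1.
Proof.
move=> jk; have wj : w ^+ j != 0 by rewrite -cmod_gt0 w_unit.
by apply: (mulIf wj); rewrite -exprD subnK// (prim_expr_order wk) mulVf.
Qed.

(** The index is l = k - 2 j with j = k/2 - i rounded down, so 2 i z0 = i pi - 2 pi i j/k and x is
    the root w^(-j). Since 0 < j < k, it is not 1. The factor - 4 is (- 2 i)^2. *)
Lemma dlog_theta2_sqr i : (i < k./2)%N ->
  dlog (fun z => theta2 z tau) ((i.*2 + odd k)%:R * cpi R / (2 * k%:R)) ^+ 2
  = - 4 * rho q (w ^+ (k./2 - i)) ^+ 2.
Proof.
move=> im; set j := (k./2 - i)%N; set z0 := _ / _.
have kE := odd_double_half k.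
have j0 : (0 < j)%N by rewrite subn_gt0.
have jk : (j < k)%N by rewrite /j; lia.
have kn0 : k%:R != 0 :> CC R by rewrite pnatr_eq0 -lt0n.
have lE : (i.*2 + odd k)%:R = k%:R - 2 * j%:R :> CC R.
  apply/eqP; rewrite eq_sym subr_eq -natrM -natrD; apply/eqP; congr _%:R.
  by rewrite /j; lia.
have w0E : cexp (twoci * z0) = - (w ^+ j)^-1.
  have -> : twoci * z0 = ci R * cpi R + - (twopii / k%:R * j%:R).
    by rewrite /z0 lE /twoci /twopii; field.
  by rewrite cexpD cexp_pi cexpN cexpMn mulN1r.
have wj0 : w ^+ j != 0 by rewrite -cmod_gt0 w_unit.
have wj1 := w_neq1 (introT andP (conj j0 jk)).
have h1 : cmod (cexp (twoci * z0)) = 1 by rewrite w0E cmodN cmodV w_unit invr1.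
have h2 : 1 + cexp (twoci * z0) != 0.
  rewrite w0E (_ : 1 - _ = - (1 - w ^+ j) / w ^+ j); last by field.
  by rewrite mulf_neq0 ?oppr_eq0 ?invr_eq0.
have [L cL hd] := theta2_has_dlog tau0 h1 h2.
rewrite (dlog_eq hd) exprMn; rewrite w0E opprK in cL *.
rewrite -(rho_eq cL) rho_inv//.
have ci2 : ci R ^+ 2 = -1 by exact: sqr_i.
by rewrite exprMn ci2; ring.
Qed.

Lemma Ssum0_rho :
  Ssum 0 k tau = - 2 * \sum_(1 <= j < k) rho q (w ^+ j) ^+ 2.
Proof.
rewrite /Ssum addn0 sum_parity (eq_big_nat _ _ (F2 := fun i =>
  - 4 * rho q (w ^+ (k./2 - i)) ^+ 2)); last first.
  by move=> i /andP[_ im]; exact: dlog_theta2_sqr.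
rewrite (sum_fold (phi := fun j => rho q (w ^+ j) ^+ 2)).
- rewrite -mulr_sumr big_nat_rev [in RHS]big_add1/=.
  rewrite (eq_big_nat _ _ (F2 := fun i => rho q (w ^+ i.+1) ^+ 2)); first by ring.
  by move=> i im; congr (rho q (w ^+ _) ^+ 2); lia.
- move=> j jk; rewrite w_sub; last by lia.
  by rewrite rho_inv ?sqrrN// w_neq1.
(* Here the root is its own inverse, and oddness forces [rho] to vanish at it. *)
- move=> ek; have kE := odd_double_half k; rewrite (negbTE ek) add0n in kE.
  have jk : (0 < k./2 < k)%N by lia.
  have := rho_inv q1 (w_unit k./2) (w_neq1 jk).
  rewrite -w_sub; last by lia.
  have -> : (k - k./2 = k./2)%N by lia.
  move=> /eqP; rewrite -addr_eq0 -mulr2n mulrn_eq0/= => /eqP ->.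
  by rewrite expr0n.
Qed.

Let unit_sqr (t : CC R) : 1 - t != 0 ->
  t / (1 - t) + (t / (1 - t)) ^+ 2 = t / (1 - t) ^+ 2.
Proof. by move=> t1; field. Qed.

Let qX_neq1 m : (0 < m)%N -> (q ^+ m) ^+ k != 1.
Proof.
case: m => // m _; rewrite -exprM.
have := @one_subX_neq0 R q (m.+1 * k).-1 q1.
by rewrite prednK ?muln_gt0// subr_eq0 eq_sym.
Qed.

Lemma sum_lambert_root m : (0 < m)%N ->
  \sum_(1 <= j < k) lambert q (w ^+ j) m
  = k%:R * lambert (q ^+ k) 1 m - lambert q 1 m.
Proof.
move=> m0; have := sum_root_geometric wk (qX_neq1 m0).
rewrite big_ltn// expr0 /lambert !mulr1 [(q ^+ k) ^+ m]exprAC => <-.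
by rewrite [RHS]addrAC subrr add0r.
Qed.

Lemma sum_lambert_root2 m : (0 < m)%N ->
  \sum_(1 <= j < k) (lambert q (w ^+ j) m + lambert q (w ^+ j) m ^+ 2)
  = k%:R ^+ 2 * (lambert (q ^+ k) 1 m + lambert (q ^+ k) 1 m ^+ 2)
    - (lambert q 1 m + lambert q 1 m ^+ 2).
Proof.
move=> m0; have := sum_root_geometric2 wk (qX_neq1 m0).
rewrite big_ltn// expr0 /lambert !mulr1 [(q ^+ k) ^+ m]exprAC => h.
have yk : 1 - (q ^+ m) ^+ k != 0 by rewrite subr_eq0 eq_sym qX_neq1.
have y1 : 1 - q ^+ m != 0 by rewrite -(prednK m0) one_subX_neq0.
rewrite (unit_sqr yk) (unit_sqr y1) -h.
rewrite [RHS]addrAC subrr add0r; apply: eq_big_nat => j jk; apply: unit_sqr.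
exact: one_sub_qXM_neq0 (w_unit j) (w_neq1 jk) _.
Qed.

Let sum_inv (f : CC R -> CC R) :
  \sum_(1 <= j < k) f (w ^+ j)^-1 = \sum_(1 <= j < k) f (w ^+ j).
Proof.
rewrite -[RHS](sum_reflect (fun j => f (w ^+ j))).
by apply: eq_big_nat => j jk; rewrite w_sub//; lia.
Qed.

(** The limit formula for [rho] squared is summed over the roots, where u and v contribute equally.
    With [lambert_divisor_sum] only P1 and Pk are left: Pk gets 2 k^2 - 4 k, and P1 gets - 2 + 4 - 2
    (k - 1), both multiples of k - 2. *)
Lemma sum_rho_sqr (P1 Pk : CC R) :
  \sum_(1 <= d < N.+1) d%:R * lambert q 1 d @[N --> \oo] --> P1 ->
  \sum_(1 <= d < N.+1) d%:R * lambert (q ^+ k) 1 d @[N --> \oo] --> Pk ->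
  \sum_(1 <= j < k) rho q (w ^+ j) ^+ 2
  = - 2 * (k%:R - 2) * ((k%:R - 1) / 24 + P1 - k%:R * Pk).
Proof.
move=> c1 ck.
have qk1 : cmod (q ^+ k) < 1 by rewrite -(prednK k0) cmodX_lt1.
have d1 := cvg_geo_diff (lambert_divisor_sum q1) c1.
have dk := cvg_geo_diff (lambert_divisor_sum qk1) ck.
have cs := seq_cvg_sum (fun j jk =>
  cotangent_square_cvg q1 (w_unit j) (w_neq1 jk) c1).
pose two : CC R := 2.
have cl := seq_cvgB
  (seq_cvgM (@seq_cvg_cst R two) (seq_cvgB (seq_cvgM (@seq_cvg_cst R (k%:R ^+ 2)) dk) d1))
  (seq_cvgM (@seq_cvg_cst R two)
    (seq_cvgM (@seq_cvg_cst R two) (seq_cvgB (seq_cvgM (@seq_cvg_cst R k%:R) ck) c1))).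
have e : \sum_(1 <= j < k) (rho q (w ^+ j) ^+ 2
      - (1 / 2 + w ^+ j / (1 - w ^+ j)) ^+ 2 + 2 * P1)
    = two * (k%:R ^+ 2 * Pk - P1) - two * (two * (k%:R * Pk - P1)).
  apply: (seq_cvg_unique cs); apply: cvg_trans cl.
  apply: near_eq_cvg; apply: nearW => N /=.
  rewrite sumrB -[in RHS]mulr_sumr.
  rewrite [X in _ = X - _]exchange_big [X in _ = _ - _ * X]exchange_big/=.
  congr (_ - _).
    rewrite mulr_sumr -sumrB mulr_sumr; apply: eq_big_nat => m /andP[m0 _].
    rewrite [RHS]big_split/= (sum_inv (fun x => lambert q x m + lambert q x m ^+ 2)).
    by rewrite sum_lambert_root2// /two; ring.
  congr (_ * _).
  rewrite mulr_sumr -sumrB mulr_sumr; apply: eq_big_nat => m /andP[m0 _].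
  rewrite -[RHS]mulr_sumr big_split/= (sum_inv (fun x => lambert q x m)).
  by rewrite sum_lambert_root// /two; ring.
(* Each square is 1/4 + t/(1 - t)^2 with t = w^j, which [sum_root_one] evaluates. *)
have sq : \sum_(1 <= j < k) (1 / 2 + w ^+ j / (1 - w ^+ j)) ^+ 2
    = (k%:R - 1) / 4 - (k%:R ^+ 2 - 1) / 12.
  rewrite (eq_big_nat _ _ (F2 := fun j => 1 / 4 + w ^+ j / (1 - w ^+ j) ^+ 2)).
    rewrite big_split/= (sum_root_one wk) sumr_const_nat -[(1 / 4) *+ _]mulr_natl natrB//.
    by field.
  by move=> j jk; have := w_neq1 jk; move: (w ^+ j) => t t1; field.
move: e; rewrite big_split/= sumrB sq sumr_const_nat -[(2 * P1) *+ _]mulr_natl natrB//.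
move: (\sum_(1 <= j < k) _) => S /eqP; rewrite -subr_eq0 => /eqP e.
by apply/eqP; rewrite -subr_eq0; apply/eqP; rewrite -[RHS]e /two; field.
Qed.

Lemma Ssum0_eq (P1 Pk : CC R) :
  \sum_(1 <= d < N.+1) d%:R * lambert q 1 d @[N --> \oo] --> P1 ->
  \sum_(1 <= d < N.+1) d%:R * lambert (q ^+ k) 1 d @[N --> \oo] --> Pk ->
  Ssum 0 k tau = 4 * (k%:R - 2) * ((k%:R / 24 - k%:R * Pk) - (1 / 24 - P1)).
Proof.
by move=> c1 ck; rewrite Ssum0_rho (sum_rho_sqr c1 ck); field.
Qed.

Lemma lambert_sum_cvg : exists P : CC R,
  \sum_(1 <= d < N.+1) d%:R * lambert (q ^+ k) 1 d @[N --> \oo] --> P.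
Proof.
have qk1 : cmod (q ^+ k) < 1 by rewrite -(prednK k0) cmodX_lt1.
exact: geo_series_from1 (geo_natM (geo_lambert1 qk1)).
Qed.

End RootSum.

(* The points l pi / (4 k) with l even are the points l pi / (2 k). *)
Lemma Ssum_double k : Ssum 0 (2 * k) tau = Ssum 0 k tau + Ssum 1 k tau.
Proof.
rewrite /Ssum !addn0 sum_parity mul2n odd_double doubleK.
have pointE l : (l.*2 + false)%:R * cpi R / (2 * k.*2%:R) = l%:R * cpi R / (2 * k%:R).
  rewrite addn0 -!muln2 !natrM !invfM.
  by move: (k%:R^-1 : CC R) (l%:R : CC R) => K L; field.
rewrite (bigID (fun l => l == k %[mod 2]))/=; congr (_ + _).
  by apply: eq_bigr => l _; rewrite pointE.
apply: eq_big => [l|l _]; last by rewrite pointE.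
by rewrite addn1 !modn2 /=; case: (odd l); case: (odd k).
Qed.

End Evaluation.


Unset Implicit Arguments.

Theorem theorem1p4 (R : realType) (k : nat) (tau : CC R)
    (hk : (2 <= k)%N) (htau : 0 < complex.Im tau) :
  Ssum 0 k tau
    = 4 * (k%:R - 2) * qdq_log (fun t => eta (k%:R * t) / eta t) tau
  /\
  Ssum 1 k tau
    = 4 * qdq_log (fun t => eta ((2 * k)%:R * t) ^+ (2 * k - 2)
                            / (eta t ^+ k * eta (k%:R * t) ^+ (k - 2))) tau.
Proof.
have k0 : (0 < k)%N by exact: ltnW.
have k20 : (0 < 2 * k)%N by rewrite muln_gt0.
have [P1 c1] := lambert_sum_cvg htau (ltn0Sn 0).
have [Pk ck] := lambert_sum_cvg htau k0.
have [P2 c2] := lambert_sum_cvg htau k20.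
have d1 := eta_has_dlog htau (ltn0Sn 0) c1.
have dk := eta_has_dlog htau k0 ck.
have d2 := eta_has_dlog htau k20 c2.
rewrite expr1 in c1.
rewrite (_ : (fun t => eta (1%:R * t)) = @eta R) in d1; last first.
  by apply/funext => t; rewrite mul1r.
have S0 := Ssum0_eq htau k0 c1 ck.
have S2 := Ssum0_eq htau k20 c1 c2.
have t0 := @twopii_neq0 R.
split.
  rewrite S0 /qdq_log (dlog_eq (has_dlogM dk (has_dlogV d1))) -/twopii.
  by field.
(* The exponents in the second formula are the coefficients of this difference: 2 k - 2 for eta(2 k
   tau), - (k - 2) for eta(k tau), and (k - 2) - (2 k - 2) = - k for eta(tau). *)
have -> : Ssum 1 k tau = Ssum 0 (2 * k) tau - Ssum 0 k tau.
  by rewrite Ssum_double addrC addKr.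
rewrite S0 S2 /qdq_log (dlog_eq (has_dlogM (has_dlogX (2 * k - 2) d2)
  (has_dlogV (has_dlogM (has_dlogX k d1) (has_dlogX (k - 2) dk))))) -/twopii.
rewrite !natrB//; last by rewrite leq_pmulr.
by rewrite !natrM; field.
Qed.
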